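(* There exist two equivalent $C^{\infty}$ flows $\varphi$ and $\widehat{\varphi}$ on the two-dimensional sphere $\mathbb{S}^2$ such that $$EP(\varphi)=0\qquad\text{and}\qquad EP(\widehat{\varphi})=\infty .$$
   Context: A flow on a manifold $M$ is a continuous map $\phi:M\times\mathbb{R}\to M$ with $\phi(x,0)=x$ and $\phi(\phi(x,s),t)=\phi(x,s+t)$; it is $C^\infty$ if it is the flow of a $C^\infty$ vector field. Two flows $\phi,\psi$ on $M$ are equivalent if there is a homeomorphism $\pi:M\to M$ sending each orbit of $\phi$ onto an orbit of $\psi$ while preserving the time orientation, i.e. $\{\phi(x,t):t\in\mathbb{R}\}=\{\pi^{-1}\psi(\pi(x),t):t\in\mathbb{R}\}$ for all $x\in M$, with the direction of time preserved. For $t>0$ let $P_t(\phi)$ be the set of isolated periodic orbits $\mathrm{orb}(\phi,x)$ (orbits having a neighborhood containing no other periodic orbit) such that $\phi(x,s)=x$ for some $0<s\le t$. The exponential growth rate of periodic orbits is $$EP(\phi)=\limsup_{t\to+\infty}\frac1t\log \#P_t(\phi),$$ where $\#$ denotes cardinality. *)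

(* Defs.v *)
From HB Require Import structures.
From mathcomp Require Import all_boot all_order all_algebra.
From mathcomp Require Import all_classical all_reals all_analysis.
Set Implicit Arguments. Unset Strict Implicit. Unset Printing Implicit Defensive.
Import Order.TTheory GRing.Theory Num.Theory.
Import numFieldNormedType.Exports.
Local Open Scope classical_set_scope.
Local Open Scope ring_scope.

Section Flows.
Variable R : realType.

Definition vec := 'rV[R]_3.

Definition S2 : set vec := [set x | \sum_(i < 3) x ord0 i ^+ 2 = 1].

Fixpoint iterD (vs : seq vec) (f : vec -> vec) : vec -> vec :=
  match vs with
  | [::] => f
  | v :: vs' => fun x => 'D_v (iterD vs' f) x
  end.

Definition smooth (f : vec -> vec) : Prop :=
  forall vs : seq vec, continuous (iterD vs f) /\
    forall (v x : vec), derivable (iterD vs f) x v.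

Definition is_flow_S2 (phi : vec -> R -> vec) : Prop :=
  [/\ forall x t, S2 x -> S2 (phi x t),
      forall x, S2 x -> phi x 0 = x,
      forall x s t, S2 x -> phi (phi x s) t = phi x (s + t) &
      {within [set p : vec * R | S2 p.1], continuous (fun p : vec * R => phi p.1 p.2)}].

(* a C^infinity flow on S^2: the flow of a C^infinity vector field
   (given as a smooth vector field on R^3, restricted to S^2) *)
Definition Cinf_flow_S2 (phi : vec -> R -> vec) : Prop :=
  is_flow_S2 phi /\
  exists V : vec -> vec, smooth V /\
    forall (x : vec) (t : R), S2 x -> is_derive t (1 : R) (phi x) (V (phi x t)).

Definition orbit (phi : vec -> R -> vec) (x : vec) : set vec := range (phi x).

Definition periodic_orbit (phi : vec -> R -> vec) (O : set vec) : Prop :=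
  exists x, [/\ S2 x, O = orbit phi x & exists s, 0 < s /\ phi x s = x].

Definition isolated_periodic_orbit (phi : vec -> R -> vec) (O : set vec) : Prop :=
  periodic_orbit phi O /\
  exists W : set vec, [/\ open W, O `<=` W &
    forall O', periodic_orbit phi O' -> O' `<=` W -> O' = O].

Definition Pt (phi : vec -> R -> vec) (t : R) : set (set vec) :=
  [set O | isolated_periodic_orbit phi O /\
     exists x, [/\ S2 x, O = orbit phi x & exists s, 0 < s <= t /\ phi x s = x]].

(* (1/t) log #P_t(phi) in the extended reals: the sup of (log n)/t over
   the n >= 1 such that P_t contains n distinct elements.  This equals
   (log #P_t)/t if P_t is finite nonempty, -oo if P_t is empty and +oo if
   P_t is infinite. *)
Definition logcard_over (phi : vec -> R -> vec) (t : R) : \bar R :=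
  ereal_sup [set ((ln n%:R) / t)%:E | n in
     [set n : nat | (0 < n)%N /\
        exists f : 'I_n -> set vec, injective f /\ forall i, Pt phi t (f i)]].

Definition EP (phi : vec -> R -> vec) : \bar R :=
  limf_esup (logcard_over phi) (pinfty_nbhs R).

Definition equivalent_flows (phi psi : vec -> R -> vec) : Prop :=
  exists pi rho : vec -> vec,
  [/\ (forall x, S2 x -> S2 (pi x)) /\ (forall x, S2 x -> S2 (rho x)),
      (forall x, S2 x -> rho (pi x) = x) /\ (forall x, S2 x -> pi (rho x) = x),
      {within S2, continuous pi} /\ {within S2, continuous rho} &
      forall x, S2 x ->
        orbit phi x = rho @` orbit psi (pi x) /\
        exists tau : R -> R, {homo tau : a b / a < b} /\
          forall t, pi (phi x t) = psi (pi x) (tau t)].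

End Flows.

(* Main.v *)
Require Import Defs.
From mathcomp Require Import all_boot all_order all_algebra.
From mathcomp Require Import all_classical all_reals all_analysis.
From mathcomp Require Import ring lra.
(* Imported again because [iterD] and [orbit] are also MathComp names. *)
Require Import Defs.
Set Implicit Arguments. Unset Strict Implicit. Unset Printing Implicit Defensive.
Import Order.TTheory GRing.Theory Num.Theory.
Import numFieldNormedType.Exports.
Local Open Scope classical_set_scope.
Local Open Scope ring_scope.

(** Let [s = (1 - z) / 2] ([height] below), which vanishes at the north pole and is
    [1] at the south pole, and let [h = exp (- 1 / s) sin^2 (pi / s)], which is smooth
    and flat at [s = 0].  The fast field rotates the sphere with unit angular speed
    and drifts towards the north pole along the meridians with speed proportional to
    [h]; the slow field is [s] times the fast one.  The coordinate [z] is monotone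
    along orbits, so the periodic orbits are the poles and the parallels [s = 1 / n],
    [n >= 2], and all but the north pole are isolated.  The two fields
    have the same oriented orbits, hence the identity is an equivalence.  The
    parallel [s = 1 / n] has period [2 pi] for the fast flow, which therefore has
    infinitely many isolated orbits of period at most [2 pi], but period [2 pi n]
    for the slow flow, which has at most linearly many of period at most [t].

    The flows are obtained from explicit integral curves.  Between two consecutive
    parallels [1 / s = n + 1 / 2 + atan p / pi] turns the drift into an equation
    [p' = G p] with [G] positive and bounded, which is solved by a quadrature;
    Gronwall's inequality then gives uniqueness, the group law and continuity. *)

(** * Primitives, monotonicity and autonomous equations on the real line *)

Section RealFunctions.
Variable R : realType.
Implicit Types (f g F G : R -> R) (a b x y t : R).

Lemma is_derive_continuous (W : normedModType R) (f : R -> W) x (l : W) :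
  is_derive x (1 : R) f l -> {for x, continuous f}.
Proof. by case=> /derivable1_diffP df _; exact: differentiable_continuous. Qed.

Lemma derive_mean_value f df a b :
  (forall x, is_derive x (1 : R) f (df x)) -> a <= b ->
  exists c, f b - f a = df c * (b - a).
Proof.
move=> fdf leab; have [|c _ ->] := @MVT_segment R f df a b leab; last by exists c.
by apply: continuous_subspaceT => x; exact: (is_derive_continuous (fdf x)).
Qed.

Lemma is_derive_ge0_le f df :
  (forall x, is_derive x (1 : R) f (df x)) -> (forall x, 0 <= df x) ->
  {homo f : x y / x <= y}.
Proof.
move=> fdf df0 x y xy; have [c /eqP] := derive_mean_value fdf xy.
by rewrite subr_eq => /eqP ->; rewrite lerDr mulr_ge0// subr_ge0.
Qed.

Lemma is_derive_gt0_lt f df :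
  (forall x, is_derive x (1 : R) f (df x)) -> (forall x, 0 < df x) ->
  {homo f : x y / x < y}.
Proof.
move=> fdf df0 x y xy; have [c /eqP] := derive_mean_value fdf (ltW xy).
by rewrite subr_eq => /eqP ->; rewrite ltrDr mulr_gt0// subr_gt0.
Qed.

Lemma continuous_has_primitive f : continuous f ->
  exists F, F 0 = 0 /\ forall x, is_derive x (1 : R) F (f x).
Proof.
move=> cf; pose mu := @lebesgue_measure R.
have fi a b : mu.-integrable `[a, b] (EFin \o f).
  apply: continuous_compact_integrable; first exact: segment_compact.
  exact: continuous_subspaceT.
pose I a x := (\int[mu]_(t in `[a, x]) f t)%R.
have dI a x : a < x -> is_derive x (1 : R) (I a) (f x).
  move=> ax.
  have x1 : x < x + 1 by rewrite ltrDl.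
  have [dF F'] := continuous_FTC1_closed x1 (fi _ _) ax (cf x).
  by split; [exact: dF|rewrite -derive1E; exact: F'].
have Isplit a b c : a <= b -> b <= c -> I a c - I a b = I b c.
  move=> ab bc.
  rewrite /I Rintegral_itvB ?bnd_simp// Rintegral_itv_obnd_cbnd//.
  by apply: integrableS (fi b c) => //; exact: subset_itv_oc_cc.
(* The signed integral from [0]: for [x != 0] one of the two intervals is empty, and at [x = 0] the
   two terms cancel. *)
pose F x := I 0 x - I x 0.
have I0 x : I x x = 0.
  by rewrite /I set_itv1 Rintegral_set1.
have Igt a b : b < a -> I a b = 0.
  by move=> ba; rewrite /I set_itv_ge ?Rintegral_set0// -leNgt bnd_simp.
exists F; split; first by rewrite /F subrr.
(* A base point to the left of both [x] and [0]: near [x], [F] is [I a] minus the constant [I a 0],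
   and the fundamental theorem applies to [I a]. *)
move=> x; pose a := Num.min x 0 - 1.
have ax : a < x by rewrite /a ltrBlDr (@le_lt_trans _ _ x)// ?ge_min ?lexx// ltrDl.
have a0 : a <= 0 by rewrite /a lerBlDr (@le_trans _ _ 0)// ge_min lexx orbT.
have FE y : a < y -> I a y - I a 0 = F y.
  move=> ay; rewrite /F; have [y0|y0|->] := ltgtP y 0.
  - by rewrite (Igt _ _ y0) sub0r -(@Isplit a y 0) ?opprB// ltW.
  - by rewrite (Igt _ _ y0) subr0 -(@Isplit a 0 y)// ltW.
  - by rewrite !subrr.
apply: (@near_eq_is_derive _ _ _ (I a - cst (I a 0))).
  near=> y; apply: FE; near: y; exact: lt_nbhsr.
rewrite -[f x]subr0; apply: is_deriveB; exact: dI.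
Unshelve. all: by end_near. Qed.

(* The autonomous equation [tau' = G tau] is solved by inverting a primitive of
   [1 / G]; the upper bound on [G] makes this primitive onto. *)
Lemma autonomous_ode_solution G M : continuous G ->
  (forall x, 0 < G x <= M) ->
  exists tau : R -> R, [/\ tau 0 = 0,
    forall t, is_derive t (1 : R) tau (G (tau t)),
    {homo tau : s t / s < t} & forall y, exists t, tau t = y].
Proof.
move=> cG GM.
have G0 x : 0 < G x by case/andP: (GM x).
have M0 : 0 < M by case/andP: (GM 0) => ? /(lt_le_trans _); apply.
have cV : continuous (fun x => (G x)^-1).
  by move=> x; apply: continuousV (cG x); rewrite gt_eqF.
have [T [T0 dT]] := continuous_has_primitive cV.
have Tlt : {homo T : x y / x < y}.
  by apply: (is_derive_gt0_lt dT) => x; rewrite invr_gt0.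
have cT : continuous T by move=> x; exact: (is_derive_continuous (dT x)).
have TM a b : a <= b -> (b - a) / M <= T b - T a.
  move=> ab; have [c ->] := derive_mean_value dT ab.
  rewrite mulrC ler_wpM2r ?subr_ge0// lef_pV2 ?posrE//.
  by case/andP: (GM c).
have surj v : exists x, T x == v.
  have nM : 0 <= `|v| * M by rewrite mulr_ge0// ltW.
  have [|||c _ <-] := @IVT R T (- (`|v| * M)) (`|v| * M) v.
  - by rewrite (le_trans _ nM)// oppr_le0.
  - exact: continuous_subspaceT.
  - have h1 := TM 0 _ nM; rewrite subr0 T0 subr0 mulfK ?gt_eqF// in h1.
    have h2 := TM (- (`|v| * M)) 0; rewrite sub0r opprK T0 sub0r in h2.
    rewrite mulfK ?gt_eqF// oppr_le0 in h2; have {}h2 := h2 nM.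
    apply/andP; split.
      rewrite ge_min; apply/orP; left.
      by rewrite -lerN2 (le_trans _ h2)// -normrN ler_norm.
    by rewrite le_max; apply/orP; right; rewrite (le_trans (ler_norm v)).
  - by exists c.
pose tau v := xchoose (surj v).
have tauK v : T (tau v) = v by apply/eqP; exact: (xchooseP (surj v)).
have Tinj : injective T.
  move=> x y Txy; have [/Tlt|/Tlt|//] := ltgtP x y; by rewrite Txy ltxx.
have TK x : tau (T x) = x by apply: Tinj; rewrite tauK.
exists tau; split.
- by rewrite -[0 in LHS]T0 TK.
- move=> t; rewrite -{1}(tauK t) -[G _]invrK.
  apply: is_derive_inverse (dT (tau t)) _.
  + by near=> y; rewrite TK.
  + by near=> y; exact: cT.
  + by rewrite invr_eq0 gt_eqF.
- move=> s t st; rewrite ltNge; apply/negP => ts.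
  move: ts; rewrite le_eqVlt => /predU1P[e|/Tlt].
    by move: st; rewrite -(tauK s) -(tauK t) e ltxx.
  by rewrite !tauK => /(lt_trans st); rewrite ltxx.
- by move=> y; exists (T y).
Unshelve. all: by end_near. Qed.

End RealFunctions.

(** * Flat functions [q (1 / s) exp (- 1 / s)] *)

Section FlatFunctions.
Variable R : realType.
Implicit Types (q : R -> R) (s u : R).

(** Coefficients in the variable [u = 1 / s]. The class is generated by just enough functions to
    contain [sin^2 (pi u)] and to be stable under differentiation, so every derivative of a flat
    function is again flat. *)
Inductive tame : (R -> R) -> Prop :=
| tame_cst c : tame (cst c)
| tame_id : tame id
| tame_cos : tame (fun u => cos (pi * u))
| tame_sin : tame (fun u => sin (pi * u))
| tame_add q1 q2 : tame q1 -> tame q2 -> tame (q1 + q2)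
| tame_mul q1 q2 : tame q1 -> tame q2 -> tame (q1 * q2).

Lemma is_derive_mulpi u : is_derive u (1 : R) (fun u => pi * u) pi.
Proof.
by apply: is_derive_eq; rewrite [_ *: _]mulr1.
Qed.

Lemma tame_is_derive q : tame q ->
  exists q', tame q' /\ forall u, is_derive u (1 : R) q (q' u).
Proof.
elim=> [c|||| q1 q2 t1 [p1 [tp1 d1]] t2 [p2 [tp2 d2]]
  |q1 q2 t1 [p1 [tp1 d1]] t2 [p2 [tp2 d2]]].
- by exists (cst 0); split; [exact: tame_cst|move=> u; exact: is_derive_cst].
- by exists (cst 1); split; [exact: tame_cst|move=> u; exact: is_derive_id].
- exists (cst (- pi) * (fun u => sin (pi * u))); split.
    by apply: tame_mul; [exact: tame_cst|exact: tame_sin].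
  move=> u.
  apply: (is_derive_eq (is_derive1_comp (is_derive_cos _) (is_derive_mulpi u))).
  by rewrite /= mulNr mulrC -mulNr.
- exists (cst pi * (fun u => cos (pi * u))); split.
    by apply: tame_mul; [exact: tame_cst|exact: tame_cos].
  move=> u.
  apply: (is_derive_eq (is_derive1_comp (is_derive_sin _) (is_derive_mulpi u))).
  by rewrite /= mulrC.
- by exists (p1 + p2); split; [exact: tame_add|move=> u; exact: is_deriveD].
- exists (q1 * p2 + q2 * p1); split.
    by apply: tame_add; exact: tame_mul.
  by move=> u; exact: is_deriveM.
Qed.

(** Polynomial growth is what [exp (- u)] has to beat. On [u >= 1], that is [0 < s <= 1], powers
    increase with the exponent, so degrees may simply be added. *)
Lemma tame_bound q : tame q -> exists (C : R) (k : nat), 0 <= C /\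
  forall u, 1 <= u -> `|q u| <= C * u ^+ k.
Proof.
elim=> [c|||| q1 q2 t1 [C [k [C0 b1]]] t2 [D [l [D0 b2]]]
  |q1 q2 t1 [C [k [C0 b1]]] t2 [D [l [D0 b2]]]].
- by exists `|c|, 0%N; split => // u _; rewrite expr0 mulr1.
- exists 1, 1%N; split => // u u1.
  by rewrite mul1r expr1 ger0_norm// (le_trans ler01).
- by exists 1, 0%N; split => // u _; rewrite expr0 mulr1 cos_max.
- by exists 1, 0%N; split => // u _; rewrite expr0 mulr1 sin_max.
- exists (C + D), (k + l)%N; split; first exact: addr_ge0.
  move=> u u1; rewrite (le_trans (ler_normD _ _))// mulrDl lerD//.
    rewrite (le_trans (b1 _ u1))// ler_wpM2l// ler_weXn2l// leq_addr//.
  by rewrite (le_trans (b2 _ u1))// ler_wpM2l// ler_weXn2l// leq_addl.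
- exists (C * D), (k + l)%N; split; first exact: mulr_ge0.
  move=> u u1; rewrite normrM exprD mulrACA ler_pM//; [exact: b1|exact: b2].
Qed.

Definition flat q s := if 0 < s then q s^-1 * expR (- s^-1) else 0.

Lemma flat_le0 q s : s <= 0 -> flat q s = 0.
Proof. by rewrite /flat leNgt => /negbTE ->. Qed.

Lemma flat_gt0 q s : 0 < s -> flat q s = q s^-1 * expR (- s^-1).
Proof. by rewrite /flat => ->. Qed.

(** If [q] has degree [k] in [u = 1 / s], the inequality [exp u >= u^(k+2) / (k+2)!] leaves a factor
    [u^-2 = s^2]. *)
Lemma flat_bound q : tame q ->
  exists2 C : R, 0 <= C & forall s, s <= 1 -> `|flat q s| <= C * s ^+ 2.
Proof.
move=> /tame_bound[C [k [C0 bq]]].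
exists (C * (k.+2)`!%:R); first by rewrite mulr_ge0.
move=> s s1; have [s0|s0] := leP s 0.
  by rewrite flat_le0// normr0 mulr_ge0 ?sqr_ge0// mulr_ge0.
have u1 : 1 <= s^-1 by rewrite invf_ge1.
rewrite flat_gt0// normrM (ger0_norm (expR_ge0 _)) expRN.
have e0 := expR_gt0 s^-1.
rewrite ler_pdivrMr//.
rewrite (le_trans (bq _ u1))// -!mulrA ler_wpM2l// mulrA.
have := @expR_ge1Dxn R s^-1 k.+1 (ltW (lt_le_trans ltr01 u1)).
have f0 : 0 < (k.+2)`!%:R :> R by rewrite ltr0n fact_gt0.
set E := expR _ => hE.
have : s^-1 ^+ k.+2 / (k.+2)`!%:R <= E by rewrite (le_trans _ hE)// lerDr.
rewrite ler_pdivrMr// => {}hE.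
have -> : s^-1 ^+ k = s ^+ 2 * s^-1 ^+ k.+2.
  by rewrite -[k.+2]addn2 exprD mulrC -mulrA -exprMn mulVf ?gt_eqF// expr1n mulr1.
rewrite [leRHS](_ : _ = s ^+ 2 * (E * (k.+2)`!%:R)); last by ring.
by rewrite ler_wpM2l ?sqr_ge0.
Qed.

Lemma flat_continuous0 q : tame q -> {for 0, continuous (flat q)}.
Proof.
move=> /flat_bound[C C0 bq].
apply/cvgrPdist_le => /= e e0.
have d0 : 0 < Num.min 1 (e / (C + 1)).
  by rewrite lt_min ltr01 divr_gt0// ltr_wpDl.
near=> s.
have : `|s| <= Num.min 1 (e / (C + 1)).
  near: s; exists (Num.min 1 (e / (C + 1))) => //= t.
  by rewrite /ball_/= sub0r normrN => /ltW.
rewrite le_min => /andP[s1 se].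
rewrite (@flat_le0 q 0)// sub0r normrN (le_trans (bq s _))//.
  exact: le_trans (ler_norm s) s1.
rewrite -real_normK ?num_real// expr2.
apply: (@le_trans _ _ (C * `|s|)).
  by rewrite ler_wpM2l// ler_piMl.
move: se; rewrite ler_pdivlMr ?ltr_wpDl// => /(le_trans _); apply.
by rewrite mulrC ler_wpM2l// lerDl.
Unshelve. all: by end_near. Qed.

(* In the variable [u = s^-1] one has [d/ds = - u^2 d/du], and at [s = 0] the
   identity [flat q s = flat (u q) s * s] gives the Caratheodory slope. *)
Lemma flat_is_derive q : tame q ->
  exists q', tame q' /\ forall s, is_derive s (1 : R) (flat q) (flat q' s).
Proof.
move=> tq; have [p [tp dp]] := tame_is_derive tq.
exists (cst (-1) * (id * id) * (p + cst (-1) * q)); split.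
  apply: tame_mul; first by do !apply: tame_mul;
    [exact: tame_cst|exact: tame_id|exact: tame_id].
  by apply: tame_add => //; apply: tame_mul => //; exact: tame_cst.
move=> s; have [s0|s0|->] := ltgtP s 0.
- rewrite flat_le0 ?ltW//.
  apply: (@near_eq_is_derive _ _ _ (cst 0)).
    near=> t; rewrite flat_le0//; apply: ltW; near: t; exact: lt_nbhsl.
- apply: (@near_eq_is_derive _ _ _ ((q \o GRing.inv) * (expR \o (fun t => - t^-1)))).
    near=> t; rewrite flat_gt0//; near: t; exact: lt_nbhsr.
  have sn : s != 0 by rewrite gt_eqF.
  have di : is_derive s (1 : R) (fun t : R => t^-1) (- s ^- 2).
    apply: (is_derive_eq (is_deriveV sn (is_derive_id s 1))).
    by rewrite [_ *: _]mulr1.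
  have dn : is_derive s (1 : R) (fun t : R => - t^-1) (- - s ^- 2).
    exact: is_deriveN.
  apply: (is_derive_eq (is_deriveM (is_derive1_comp (dp _) di)
    (is_derive1_comp (is_derive_expR _) dn))).
  rewrite flat_gt0//= !fctE /= /GRing.scale /= -exprVn; ring.
- rewrite flat_le0//; apply/is_derive1_caratheodory; exists (flat (id * q)); split.
  + move=> t; rewrite (@flat_le0 _ 0)// !subr0; have [t0|t0] := leP t 0.
      by rewrite !flat_le0// mul0r.
    by rewrite !flat_gt0//= !fctE /=; field; rewrite gt_eqF.
  + by apply: flat_continuous0; apply: tame_mul => //; exact: tame_id.
  + by rewrite flat_le0.
Unshelve. all: by end_near. Qed.

(** The derivative is flat too, hence bounded on [[0, 1]], and the mean value theorem applies. A
    single constant serves as bound and as Lipschitz constant, the pair that products require. *)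
Lemma flat_lipschitz q : tame q -> exists K : R, [/\ 0 <= K,
  forall s, s <= 1 -> s >= 0 -> `|flat q s| <= K &
  forall s t, s <= 1 -> t <= 1 -> s >= 0 -> t >= 0 ->
    `|flat q s - flat q t| <= K * `|s - t|].
Proof.
move=> tq; have [p [tp dp]] := flat_is_derive tq.
have [C C0 bC] := flat_bound tq; have [D D0 bD] := flat_bound tp.
exists (C + D); split; first exact: addr_ge0.
  move=> s s1 s0; rewrite (le_trans (bC _ s1))// (@le_trans _ _ C) ?lerDl//.
  by rewrite ler_piMr// exprn_ile1.
move=> s t; wlog st : s t / t <= s => [H s1 t1 s0 t0|s1 t1 s0 t0].
  have [ts|/ltW st] := leP t s; first exact: H.
  by rewrite distrC (distrC s); exact: H.
have [|c ctu ->] := @MVT_segment R (flat q) (flat p) t s st.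
  by apply: continuous_subspaceT => x; exact: (is_derive_continuous (dp x)).
move: ctu; rewrite in_itv/= => /andP[tc cs].
rewrite normrM ler_wpM2r//.
have c1 : c <= 1 by exact: le_trans cs s1.
rewrite (le_trans (bD _ c1))// (@le_trans _ _ D) ?lerDr//.
by rewrite ler_piMr// exprn_ile1// (le_trans t0).
Qed.

End FlatFunctions.

(** * Coordinatewise limits and directional derivatives *)

Section RowFunctions.
Variable R : realType.

Lemma cvg_row (T : Type) (F : set_system T) (n : nat) (f : 'I_n -> T -> R)
    (l : 'I_n -> R) : Filter F ->
  (forall i, f i x @[x --> F] --> l i) ->
  (\row_i f i x) @[x --> F] --> \row_i l i.
Proof.
move=> FF fl; apply/cvgrPdist_le => /= e e0; near=> x.
rewrite [leLHS]/Num.Def.normr/= mx_normrE (bigmax_le _ (ltW e0))//= => -[i j] _.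
rewrite !mxE /=; move: j; near: x; apply: filter_forall => j.
by move/cvgrPdist_le : (fl j) => /(_ _ e0).
Unshelve. all: by end_near. Qed.

Lemma is_derive_row (V : normedModType R) (n : nat) (f : 'I_n -> V -> R)
    (l : 'I_n -> R) (x v : V) :
  (forall i, is_derive x v (f i) (l i)) ->
  is_derive x v (fun y => \row_i f i y) (\row_i l i).
Proof.
move=> fl.
have E i j : (fun y => (\row_i f i y) i j) = f j by apply/funext => y; rewrite mxE.
have dr : derivable (fun y => \row_i f i y) x v.
  by apply/derivable_mxP => i j; rewrite E; case: (fl j).
split; first exact: dr.
by rewrite derive_mx//; apply/rowP => j; rewrite !mxE E; case: (fl j).
Qed.

Lemma is_derive_coordinate (V : normedModType R) (n : nat) (f : V -> 'rV[R]_n)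
    (l : 'rV[R]_n) (x v : V) i :
  is_derive x v f l -> is_derive x v (fun y => f y ord0 i) (l ord0 i).
Proof.
move=> [df <-]; split; first by move/derivable_mxP : df.
by rewrite derive_mx// mxE.
Qed.

(** Restricting to the line through [x] along [v] makes the one-variable chain rule available for
    directional derivatives. *)
Lemma is_derive_lineP (V W : normedModType R) (f : V -> W) (x v : V) (l : W) :
  is_derive x v f l <-> is_derive (0 : R) (1 : R) (fun h => f (h *: v + x)) l.
Proof.
have E : (fun h : R => h^-1 *:
    (((fun h : R => f (h *: v + x)) \o shift 0) (h *: (1 : R)) - f (0 *: v + x))) =
  (fun h : R => h^-1 *: ((f \o shift x) (h *: v) - f x)).
  by apply/funext => h /=; rewrite scale0r add0r addr0 [h *: 1]mulr1.
split=> -[d e]; split.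
- by rewrite /derivable E.
- by rewrite /derive E.
- by move: d; rewrite /derivable E.
- by move: e; rewrite /derive E.
Qed.

Lemma is_derive_comp_dir (V : normedModType R) (g : R -> R) (f : V -> R)
    (x v : V) (a b : R) :
  is_derive (f x) (1 : R) g a -> is_derive x v f b ->
  is_derive x v (g \o f) (a * b).
Proof.
move=> dg /is_derive_lineP df; apply/is_derive_lineP.
by apply: (@is_derive1_comp _ g (fun h => f (h *: v + x))) df; rewrite scale0r add0r.
Qed.

End RowFunctions.

(** * A class of smooth functions on space, stable under directional derivatives *)

Section ElementaryFields.
Variable R : realType.
Local Notation vec := (vec R).
Implicit Types (f : vec -> R) (x y v : vec).

Definition height (x : vec) : R := (1 - x ord0 (inord 2)) / 2.

(** Contains the coordinates of both fields. Stability under directional derivatives turns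
    smoothness into an induction on the list of directions, each member being continuous. *)
Inductive elem : (vec -> R) -> Prop :=
| elem_cst c : elem (cst c)
| elem_coord i : elem (fun x => x ord0 i)
| elem_flat q : tame q -> elem (flat q \o height)
| elem_add f g : elem f -> elem g -> elem (f + g)
| elem_mul f g : elem f -> elem g -> elem (f * g).

Lemma is_derive_height x v : is_derive x v height (- (v ord0 (inord 2)) / 2).
Proof.
have dc : is_derive x v (fun y : vec => y ord0 (inord 2)) (v ord0 (inord 2)).
  exact: (is_derive_coordinate _ (is_derive_id x v)).
have -> : height = (2^-1 : R) \*: (cst (1 : R) - (fun y : vec => y ord0 (inord 2))).
  by apply/funext => y; rewrite /height mulrC.
apply: (is_derive_eq (is_deriveZ _ (is_deriveB (is_derive_cst _ _ _) dc))).
by rewrite sub0r [_ *: _]mulrC.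
Qed.

Lemma elem_is_derive f v : elem f ->
  exists f', elem f' /\ forall x, is_derive x v f (f' x).
Proof.
elim=> [c|i|q tq|f1 f2 e1 [g1 [eg1 d1]] e2 [g2 [eg2 d2]]
  |f1 f2 e1 [g1 [eg1 d1]] e2 [g2 [eg2 d2]]].
- by exists (cst 0); split; [exact: elem_cst|move=> x; exact: is_derive_cst].
- exists (cst (v ord0 i)); split; first exact: elem_cst.
  by move=> x; exact: (is_derive_coordinate _ (is_derive_id x v)).
- have [p [tp dp]] := flat_is_derive tq.
  exists ((flat p \o height) * cst (- (v ord0 (inord 2)) / 2)); split.
    by apply: elem_mul; [exact: elem_flat|exact: elem_cst].
  by move=> x; exact: (is_derive_comp_dir (dp _) (is_derive_height x v)).
- by exists (g1 + g2); split; [exact: elem_add|move=> x; exact: is_deriveD].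
- exists (f1 * g2 + f2 * g1); split; first by apply: elem_add; exact: elem_mul.
  by move=> x; exact: is_deriveM.
Qed.

Lemma height_continuous : continuous height.
Proof.
move=> x; have FF : Filter (nbhs x) by exact: nbhs_filter.
apply: cvgM; last exact: cst_continuous.
by apply: cvgB; [exact: cst_continuous|exact: (@coord_continuous R 1 3)].
Qed.

Lemma elem_continuous f : elem f -> continuous f.
Proof.
elim=> [c|i|q tq|f1 f2 e1 c1 e2 c2|f1 f2 e1 c1 e2 c2] x.
- exact: cst_continuous.
- exact: (@coord_continuous R 1 3 ord0 i x).
- apply: continuous_comp; first exact: height_continuous.
  by have [p [_ dp]] := flat_is_derive tq; exact: (is_derive_continuous (dp _)).
- have FF : Filter (nbhs x) by exact: nbhs_filter.
  by apply: cvgD; [exact: c1|exact: c2].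
- have FF : Filter (nbhs x) by exact: nbhs_filter.
  by apply: cvgM; [exact: c1|exact: c2].
Qed.

Lemma iterD_elem (vs : seq vec) (f : 'I_3 -> vec -> R) : (forall i, elem (f i)) ->
  exists g : 'I_3 -> vec -> R, (forall i, elem (g i)) /\
    iterD vs (fun x => \row_i f i x) = (fun x => \row_i g i x).
Proof.
move=> ef; elim: vs => [|v vs [g [eg IH]]]; first by exists f.
have /choice[g' g'P] i := elem_is_derive v (eg i).
exists g'; split; first by move=> i; exact: (g'P i).1.
apply/funext => x /=; rewrite IH.
by apply: (@derive_val _ _ _ _ _ _ _ (is_derive_row (fun i => (g'P i).2 x))).
Qed.

Lemma smooth_elem (f : 'I_3 -> vec -> R) : (forall i, elem (f i)) ->
  smooth (fun x => \row_i f i x).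
Proof.
move=> ef vs; have [g [eg ->]] := iterD_elem vs ef; split.
  by move=> x; apply: (cvg_row (nbhs_filter x)) => i; exact: elem_continuous.
move=> v x; have /choice[g' g'P] i := elem_is_derive v (eg i).
by have [] := is_derive_row (fun i => (g'P i).2 x).
Qed.

Definition l1dist x y : R := \sum_(i < 3) `|x ord0 i - y ord0 i|.

Lemma coord_le_l1dist x y i : `|x ord0 i - y ord0 i| <= l1dist x y.
Proof. by rewrite /l1dist (bigD1 i)//= lerDl sumr_ge0. Qed.

(** Induction on the class; the product case needs the bounds of the factors besides their Lipschitz
    constants. The cube of side [2] contains the sphere, and on it the height stays in [[0, 1]],
    where [flat_lipschitz] applies. *)
Lemma elem_lipschitz f : elem f -> exists K : R, [/\ 0 <= K,
  forall x, (forall i, `|x ord0 i| <= 1) -> `|f x| <= K &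
  forall x y, (forall i, `|x ord0 i| <= 1) -> (forall i, `|y ord0 i| <= 1) ->
    `|f x - f y| <= K * l1dist x y].
Proof.
have l1ge0 x y : 0 <= l1dist x y by apply: sumr_ge0.
elim=> [c|i|q tq|f1 f2 e1 [K [K0 b1 l1]] e2 [L [L0 b2 l2]]
  |f1 f2 e1 [K [K0 b1 l1]] e2 [L [L0 b2 l2]]].
- exists `|c|; split=> // x y _ _; by rewrite subrr normr0 mulr_ge0.
- exists 1; split=> // x y _ _; by rewrite mul1r coord_le_l1dist.
- have [K [K0 bK lK]] := flat_lipschitz tq.
  have hP x : (forall i, `|x ord0 i| <= 1) -> height x <= 1 /\ 0 <= height x.
    by move=> /(_ (inord 2)); rewrite ler_norml /height; lra.
  exists K; split=> // [x /hP[? ?]|x y /hP[? ?] /hP[? ?]] /=; first exact: bK.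
  apply: (le_trans (lK _ _ _ _ _ _)) => //; rewrite ler_wpM2l//.
  apply: le_trans (coord_le_l1dist x y (inord 2)); rewrite /height.
  set a := x _ _; set b := y _ _.
  have -> : (1 - a) / 2 - (1 - b) / 2 = (b - a) / 2 by field.
  rewrite normrM distrC ler_piMr//.
  by rewrite ger0_norm ?invr_ge0// invf_le1// ler1n.
- exists (K + L); split=> [|x cx|x y cx cy]; first exact: addr_ge0.
    by rewrite (le_trans (ler_normD _ _))// lerD// ?b1 ?b2.
  rewrite !fctE opprD addrACA (le_trans (ler_normD _ _))// mulrDl lerD//.
    exact: l1.
  exact: l2.
- exists (K * L + K * L); split=> [|x cx|x y cx cy].
  + by rewrite addr_ge0// mulr_ge0.
  + rewrite normrM (@le_trans _ _ (K * L))// ?lerDl ?mulr_ge0//.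
    by rewrite ler_pM// ?b1 ?b2.
  + rewrite !fctE.
    have -> : f1 x * f2 x - f1 y * f2 y =
      f1 x * (f2 x - f2 y) + f2 y * (f1 x - f1 y) by ring.
    rewrite (le_trans (ler_normD _ _))// mulrDl lerD// normrM.
      by rewrite -mulrA ler_pM// ?b1 ?l2.
    by rewrite (mulrC K) -mulrA ler_pM// ?b2 ?l1.
Qed.

End ElementaryFields.

(** * Gronwall's inequality and flows of Lipschitz fields on the sphere *)

Section LipschitzFlows.
Variable R : realType.
Local Notation vec := (vec R).
Implicit Types (V : vec -> vec) (x y : vec) (c d : R -> vec) (K L s t : R).

Lemma is_derive_comp_row (n : nat) (f : R -> 'rV[R]_n) (tau : R -> R) t
    (l : 'rV[R]_n) (b : R) :
  is_derive (tau t) (1 : R) f l -> is_derive t (1 : R) tau b ->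
  is_derive t (1 : R) (f \o tau) (b *: l).
Proof.
move=> df dtau.
have -> : f \o tau = (fun t => \row_i (fun t => f (tau t) ord0 i) t).
  by apply/funext => u; apply/rowP => i; rewrite mxE.
have -> : b *: l = \row_i (l ord0 i * b).
  by apply/rowP => i; rewrite !mxE mulrC.
apply: is_derive_row => i.
exact: (is_derive1_comp (is_derive_coordinate i df) dtau).
Qed.

Definition integral_curve V c := forall t, S2 (c t) /\ is_derive t (1 : R) c (V (c t)).

Definition lipschitz_S2 V K := forall x y, S2 x -> S2 y ->
  forall i, `|V x ord0 i - V y ord0 i| <= K * l1dist x y.

(** The squared Euclidean distance is differentiable along curves, as Gronwall's inequality
    requires; [l1dist] suits the Lipschitz estimates. *)
Definition sqdist x y : R := \sum_(i < 3) (x ord0 i - y ord0 i) ^+ 2.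

Lemma coord_le_sqdist x y i : (x ord0 i - y ord0 i) ^+ 2 <= sqdist x y.
Proof. by rewrite /sqdist (bigD1 i)//= lerDl sumr_ge0// => j _; rewrite sqr_ge0. Qed.

Lemma sqdist_le0 x y : sqdist x y <= 0 -> x = y.
Proof.
move=> d0; apply/rowP => i; apply/eqP; rewrite -subr_eq0 -sqrf_eq0.
by rewrite eq_le sqr_ge0 andbT (le_trans (coord_le_sqdist x y i)).
Qed.

(** Cauchy-Schwarz for three terms: the difference of the two sides is the sum of the squares of
    [a - b], [a - e] and [b - e]. *)
Lemma l1dist_le_sqdist x y : l1dist x y ^+ 2 <= 3 * sqdist x y.
Proof.
rewrite /l1dist /sqdist !big_ord_recr !big_ord0 /= !add0r.
rewrite -(real_normK (num_real (_ - y ord0 (widen_ord _ (widen_ord _ _))))).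
rewrite -(real_normK (num_real (_ - y ord0 (widen_ord _ ord_max)))).
rewrite -(real_normK (num_real (_ - y ord0 ord_max))).
set a := `|_|; set b := `|_|; set e := `|_|.
have := sqr_ge0 (a - b); have := sqr_ge0 (a - e); have := sqr_ge0 (b - e).
lra.
Qed.

(** [D t exp (- L t)] has a nonpositive derivative; [f] is its opposite, hence nondecreasing. *)
Lemma gronwall_ge0 (D dD : R -> R) L : (forall t, is_derive t (1 : R) D (dD t)) ->
  (forall t, dD t <= L * D t) -> forall t, 0 <= t -> D t <= D 0 * expR (L * t).
Proof.
move=> dDP dDL t t0; pose f t := - (D t * expR (- (L * t))).
have dE u : is_derive u (1 : R) (fun u => expR (- (L * u))) (- L * expR (- (L * u))).
  have dl : is_derive u (1 : R) (fun u => - (L * u)) (- L).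
    by apply: is_derive_eq; rewrite [_ *: _]mulr1.
  by apply: (is_derive_eq (is_derive1_comp (is_derive_expR _) dl)); rewrite mulrC.
have df u : is_derive u (1 : R) f ((L * D u - dD u) * expR (- (L * u))).
  apply: (is_derive_eq (is_deriveN (is_deriveM (dDP u) (dE u)))).
  rewrite /GRing.scale /=; ring.
have := is_derive_ge0_le df _ t0; rewrite /f mulr0 oppr0 expR0 mulr1 lerN2.
rewrite expRN ler_pdivrMr ?expR_gt0//; apply => u.
by rewrite mulr_ge0 ?expR_ge0// subr_ge0.
Qed.

(** The bound on the absolute value of [dD] is invariant under time reversal, which settles negative
    times. *)
Lemma gronwall (D dD : R -> R) L : (forall t, is_derive t (1 : R) D (dD t)) ->
  (forall t, `|dD t| <= L * D t) -> forall t, D t <= D 0 * expR (L * `|t|).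
Proof.
move=> dDP dDL t; have [t0|t0] := leP 0 t.
  rewrite ger0_norm//; apply: (gronwall_ge0 dDP) => // u.
  exact: le_trans (ler_norm _) (dDL u).
have dN u : is_derive u (1 : R) (D \o -%R) (- dD (- u)).
  by apply: (is_derive_eq (is_derive1_comp (dDP _) (is_deriveNid _ _))); rewrite mulrN1.
have := @gronwall_ge0 _ _ L dN _ (- t); rewrite /= opprK oppr0 ltr0_norm//; apply.
  by move=> u; rewrite (le_trans _ (dDL _))// -normrN ler_norm.
by rewrite oppr_ge0 ltW.
Qed.

(** The derivative of the squared distance is at most [2 K l1dist^2] in absolute value, hence at
    most [6 K] times the squared distance, and Gronwall's inequality concludes. *)
Lemma integral_curves_dist V K c d : lipschitz_S2 V K ->
  integral_curve V c -> integral_curve V d ->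
  forall t, sqdist (c t) (d t) <= sqdist (c 0) (d 0) * expR (6 * K * `|t|).
Proof.
move=> lV cV dV.
pose D t := sqdist (c t) (d t).
pose dD t := \sum_(i < 3) 2 * (c t ord0 i - d t ord0 i) *
  (V (c t) ord0 i - V (d t) ord0 i).
have dDP t : is_derive t (1 : R) D (dD t).
  have di i : is_derive t (1 : R) (fun t => c t ord0 i - d t ord0 i)
      (V (c t) ord0 i - V (d t) ord0 i).
    apply: is_deriveB; apply: is_derive_coordinate; [exact: (cV t).2|exact: (dV t).2].
  have -> : D = \sum_(i < 3) (fun t => c t ord0 i - d t ord0 i) ^+ 2.
    by apply/funext => u; rewrite fct_sumE.
  apply: is_derive_sum => i; exact: (is_deriveX 2 (di i)).
apply: (gronwall dDP) => t.
have cS := (cV t).1; have dS := (dV t).1.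
rewrite (le_trans (ler_norm_sum _ _ _))//.
apply: (@le_trans _ _ (\sum_(i < 3)
    2 * `|c t ord0 i - d t ord0 i| * (K * l1dist (c t) (d t)))).
  apply: ler_sum => i _; rewrite !normrM ger0_norm// ler_wpM2l ?mulr_ge0//.
  exact: lV.
rewrite -mulr_suml -mulr_sumr -/(l1dist _ _).
have := l1dist_le_sqdist (c t) (d t); rewrite -/(D t).
have [K0|K0] := leP 0 K.
  set l := l1dist _ _ => lD.
  rewrite [leLHS](_ : _ = 2 * K * l ^+ 2); last by ring.
  rewrite (_ : 6 * K * D t = 2 * K * (3 * D t)); last by ring.
  by rewrite ler_wpM2l// mulr_ge0.
(* For [K < 0] the Lipschitz condition itself forces [c t = d t], and both sides vanish. *)
have l0 : 0 <= l1dist (c t) (d t) by exact: sumr_ge0.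
have : l1dist (c t) (d t) = 0.
  apply/eqP; rewrite eq_le l0 andbT.
  have := lV _ _ cS dS ord0; have := normr_ge0 (V (c t) ord0 ord0 - V (d t) ord0 ord0).
  by move=> h /(le_trans h); rewrite nmulr_rge0.
move=> l1 _; rewrite l1 !mulr0.
suff -> : D t = 0 by rewrite mulr0.
rewrite /D (_ : c t = d t) /sqdist ?big1// => [i _|]; first by rewrite subrr expr0n.
apply/rowP => i; apply/eqP; rewrite -subr_eq0 -normr_eq0.
by rewrite eq_le normr_ge0 andbT -l1 coord_le_l1dist.
Qed.

Lemma integral_curve_unique V K c d : lipschitz_S2 V K ->
  integral_curve V c -> integral_curve V d -> c 0 = d 0 -> c =1 d.
Proof.
move=> lV cV dV cd t; apply: sqdist_le0.
rewrite (le_trans (integral_curves_dist lV cV dV t))// cd.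
rewrite /sqdist big1 ?mul0r// => i _.
by rewrite subrr expr0n.
Qed.

Lemma integral_curve_shift V c s :
  integral_curve V c -> integral_curve V (fun t => c (s + t)).
Proof.
move=> cV t; split; first exact: (cV _).1.
rewrite -[V _]scale1r; apply: (is_derive_comp_row (cV _).2).
by apply: is_derive_eq; rewrite add0r.
Qed.

(** The group law is uniqueness applied to a shifted curve. For joint continuity, first compare
    [phi p.1] with [phi x] at the same time [p.2], then use continuity of the single curve
    [phi x]. *)
Lemma is_flow_of_curves V K (phi : vec -> R -> vec) : lipschitz_S2 V K ->
  (forall x, S2 x -> phi x 0 = x) ->
  (forall x, S2 x -> integral_curve V (phi x)) -> is_flow_S2 phi.
Proof.
move=> lV phi0 phiV; split => //.
- by move=> x t Sx; exact: (phiV x Sx t).1.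
- move=> x s t Sx; have Ss := (phiV x Sx s).1.
  apply: (integral_curve_unique lV (phiV _ Ss) (integral_curve_shift s (phiV x Sx))).
  by rewrite phi0// addr0.
apply/subspace_continuousP => -[x t] /= Sx.
pose A := [set p : vec * R | S2 p.1].
have FF : Filter (within A (nbhs (x, t))) by exact: within_filter.
have -> : (fun p : vec * R => phi p.1 p.2) =
    (fun p => \row_i (fun p => phi p.1 p.2 ord0 i) p).
  by apply/funext => p; apply/rowP => i; rewrite mxE.
apply: cvg_row => i /=.
(* The Gronwall bound on the distance between [phi p.1 p.2] and [phi x p.2]; it is continuous in [p]
   and vanishes at [(x, t)]. *)
pose B (p : vec * R) := Num.sqrt (sqdist p.1 x * expR (6 * K * `|p.2|)).
have cB : B p @[p --> (x, t)] --> (0 : R).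
  have -> : 0 = B (x, t).
    rewrite /B /= /sqdist big1 ?mul0r ?sqrtr0// => j _.
    by rewrite subrr expr0n.
  apply: (@continuous_comp _ _ _ (fun p : vec * R => sqdist p.1 x *
    expR (6 * K * `|p.2|)) (@Num.sqrt R)); last exact: sqrt_continuous.
  have PF : Filter (nbhs (x, t)) by exact: nbhs_filter.
  apply: cvgM.
    rewrite /sqdist; apply: (@cvg_big _ _ _ _ _ add_continuous) => j _.
    apply: (@continuous_comp _ _ _ (fun p : vec * R => p.1 ord0 j - x ord0 j)
      (fun r => r ^+ 2)); last exact: exprn_continuous.
    apply: cvgB; last exact: cst_continuous.
    apply: (@continuous_comp _ _ _ fst (fun y : vec => y ord0 j)).
      exact: cvg_fst.
    exact: (@coord_continuous R 1 3 ord0 j).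
  apply: (@continuous_comp _ _ _ (fun p : vec * R => 6 * K * `|p.2|) expR).
    apply: cvgM; first exact: cst_continuous.
    apply: (@continuous_comp _ _ _ snd (fun r : R => `|r|)); first exact: cvg_snd.
    exact: norm_continuous.
  exact: continuous_expR.
have dB : (phi p.1 p.2 ord0 i - phi x p.2 ord0 i)
    @[p --> within A (nbhs (x, t))] --> (0 : R).
  apply/cvgrPdist_le => /= e e0.
  have /cvgrPdist_le/(_ e e0) nB := cB.
  apply: filterS nB => p; rewrite !sub0r !normrN => Be Sp.
  apply: le_trans Be; rewrite /B (ger0_norm (sqrtr_ge0 _)) -sqrtr_sqr ler_wsqrtr//.
  rewrite (le_trans (coord_le_sqdist _ _ i))//.
  have := integral_curves_dist lV (phiV _ Sp) (phiV _ Sx) p.2.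
  by rewrite !phi0.
have dC : phi x p.2 ord0 i @[p --> within A (nbhs (x, t))] --> phi x t ord0 i.
  apply: cvg_within_filter.
  suff H : {for (x, t), continuous ((fun s => phi x s ord0 i) \o snd)} by exact: H.
  apply: continuous_comp; first exact: cvg_snd.
  exact: (is_derive_continuous (is_derive_coordinate i (phiV x Sx t).2)).
have -> : (fun p : vec * R => phi p.1 p.2 ord0 i) =
    (fun p => phi p.1 p.2 ord0 i - phi x p.2 ord0 i + phi x p.2 ord0 i).
  by apply/funext => p; rewrite subrK.
by rewrite -[phi x t ord0 i]add0r; exact: cvgD dB dC.
Qed.

End LipschitzFlows.

(** * The fast and slow fields, and curves in cylindrical coordinates *)

Lemma sum_sqr_eq0 (F : realFieldType) (a b : F) :
  a ^+ 2 + b ^+ 2 = 0 -> a = 0 /\ b = 0.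
Proof.
by move/eqP; rewrite paddr_eq0 ?sqr_ge0// !sqrf_eq0 => /andP[/eqP -> /eqP ->].
Qed.

Section Fields.
Variable R : realType.
Local Notation vec := (vec R).
Implicit Types (x y : vec) (s t a b : R) (z lam : R -> R).

Definition row3 a b c : vec := \row_(i < 3) nth 0 [:: a; b; c] i.

Lemma row3E a b c : [/\ row3 a b c ord0 (inord 0) = a,
  row3 a b c ord0 (inord 1) = b & row3 a b c ord0 (inord 2) = c].
Proof. by split; rewrite mxE inordK. Qed.

Lemma ord3P (i : 'I_3) : [\/ i = inord 0, i = inord 1 | i = inord 2].
Proof.
case: i => -[|[|[|//]]] Hi; [constructor 1|constructor 2|constructor 3];
  by apply/val_inj; rewrite /= inordK.
Qed.

Lemma vec3P x y : x ord0 (inord 0) = y ord0 (inord 0) ->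
  x ord0 (inord 1) = y ord0 (inord 1) -> x ord0 (inord 2) = y ord0 (inord 2) ->
  x = y.
Proof. by move=> e0 e1 e2; apply/rowP => i; case: (ord3P i) => ->. Qed.

Lemma row3_eta x : x = row3 (x ord0 (inord 0)) (x ord0 (inord 1)) (x ord0 (inord 2)).
Proof.
apply: vec3P;
  by case: (row3E (x ord0 (inord 0)) (x ord0 (inord 1)) (x ord0 (inord 2))).
Qed.

Lemma S2E x : S2 x <-> x ord0 (inord 0) ^+ 2 + x ord0 (inord 1) ^+ 2 +
  x ord0 (inord 2) ^+ 2 = 1.
Proof.
rewrite /S2 /= !big_ord_recr big_ord0 /= add0r.
have -> : widen_ord (leqnSn 2) (widen_ord (leqnSn 1) ord_max) = inord 0 :> 'I_3.
  by apply/val_inj; rewrite /= inordK.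
have -> : widen_ord (leqnSn 2) ord_max = inord 1 :> 'I_3.
  by apply/val_inj; rewrite /= inordK.
have -> : ord_max = inord 2 :> 'I_3 by apply/val_inj; rewrite /= inordK.
by [].
Qed.

Lemma S2_row3 a b c : a ^+ 2 + b ^+ 2 + c ^+ 2 = 1 -> S2 (row3 a b c).
Proof. by move=> e; apply/S2E; case: (row3E a b c) => -> -> ->. Qed.

Lemma S2_coord_le1 x i : S2 x -> `|x ord0 i| <= 1.
Proof.
move=> Sx; rewrite -ler_sqr ?nnegrE// real_normK ?num_real//.
move: Sx; rewrite expr1n /S2/= (bigD1 i)//= => e; rewrite -[leRHS]e lerDl.
by rewrite sumr_ge0// => j _; rewrite sqr_ge0.
Qed.

Lemma height_S2 x : S2 x -> 0 <= height x <= 1.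
Proof. by move=> /S2_coord_le1-/(_ (inord 2)); rewrite ler_norml /height; lra. Qed.

Definition sinsq : R -> R := (fun u => sin (pi * u)) * (fun u => sin (pi * u)).

Lemma tame_sinsq : tame sinsq.
Proof. by apply: tame_mul; exact: tame_sin. Qed.

Definition drift x : R := flat sinsq (height x).

Definition coord k : vec -> R := fun x => x ord0 (inord k).

(** The rotation [(- y, x, 0)] plus [h] times [(- x z, - y z, 1 - z^2)], the spherical gradient of
    [z]. It is spelled with the constructors of [elem], so that membership is syntactic. *)
Definition fast_coord (i : 'I_3) : vec -> R := nth (cst 0)
  [:: cst (-1) * coord 1 + (flat sinsq \o @height R) * (cst (-1) * (coord 0 * coord 2));
      coord 0 + (flat sinsq \o @height R) * (cst (-1) * (coord 1 * coord 2));
      (flat sinsq \o @height R) * (cst 1 + cst (-1) * (coord 2 * coord 2))] i.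

(** The scalar factor is [height], expanded so as to be visibly in [elem]. *)
Definition slow_coord (i : 'I_3) : vec -> R :=
  (cst 2^-1 * (cst 1 + cst (-1) * coord 2)) * fast_coord i.

Definition fast_field x : vec := \row_i fast_coord i x.
Definition slow_field x : vec := \row_i slow_coord i x.

Ltac elem_tac := repeat first
  [exact: elem_coord|exact: elem_cst|exact: (elem_flat tame_sinsq)
  |apply: elem_add|apply: elem_mul].

Lemma elem_fast_coord i : elem (fast_coord i).
Proof. by rewrite /fast_coord; case: i => -[|[|[|//]]] Hi /=; elem_tac. Qed.

Lemma elem_slow_coord i : elem (slow_coord i).
Proof. by apply: elem_mul; [elem_tac|exact: elem_fast_coord]. Qed.

Lemma slow_fieldE x : slow_field x = height x *: fast_field x.
Proof.
apply/rowP => i; rewrite !mxE /slow_coord /height !fctE /= /coord.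
by congr (_ * _); rewrite mulrC mulN1r.
Qed.

Lemma fast_fieldE x :
  fast_field x = row3
    (- x ord0 (inord 1) - drift x * (x ord0 (inord 0) * x ord0 (inord 2)))
    (x ord0 (inord 0) - drift x * (x ord0 (inord 1) * x ord0 (inord 2)))
    (drift x * (1 - x ord0 (inord 2) ^+ 2)).
Proof.
apply/rowP => i; rewrite !mxE /fast_coord /drift.
by case: i => -[|[|[|//]]] Hi /=; rewrite !fctE /= /coord; ring.
Qed.

Lemma lipschitz_elem_field (f : 'I_3 -> vec -> R) : (forall i, elem (f i)) ->
  exists K, lipschitz_S2 (fun x => \row_i f i x) K.
Proof.
move=> ef; have /choice[K KP] i := elem_lipschitz (ef i).
exists (\sum_i K i) => x y Sx Sy i; rewrite !mxE.
have [Ki0 _ Li] := KP i.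
apply: (le_trans (Li x y _ _)); try by move=> j; exact: S2_coord_le1.
rewrite ler_wpM2r ?sumr_ge0// (bigD1 i)//= lerDl sumr_ge0// => j _.
by have [] := KP j.
Qed.

Lemma is_derive_row3 (f g h : R -> R) t a b c :
  is_derive t (1 : R) f a -> is_derive t (1 : R) g b -> is_derive t (1 : R) h c ->
  is_derive t (1 : R) (fun t => row3 (f t) (g t) (h t)) (row3 a b c).
Proof.
move=> df dg dh.
have := @is_derive_row R _ 3 (fun i t => nth 0 [:: f t; g t; h t] i)
  (fun i => nth 0 [:: a; b; c] i) t 1; apply.
by case=> -[|[|[|//]]] Hi.
Qed.

(* On an integral curve of the fast field the longitude has speed one and [lam]
   is the ratio of the radii of the parallels. *)
Definition spiral x z lam t : vec :=
  row3 (lam t * (x ord0 (inord 0) * cos t - x ord0 (inord 1) * sin t))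
       (lam t * (x ord0 (inord 0) * sin t + x ord0 (inord 1) * cos t)) (z t).

(** The equation [lam' = - H z lam] is required only after multiplication by the horizontal
    coordinates of [x], so that a constant [lam] is also allowed at the poles, where these
    vanish. *)
Lemma spiral_integral_curve x z lam (H L : R -> R) :
  (forall t, H t = flat sinsq ((1 - z t) / 2)) ->
  (forall t, is_derive t (1 : R) z (H t * (1 - z t ^+ 2))) ->
  (forall t, is_derive t (1 : R) lam (L t)) ->
  (forall t, L t * x ord0 (inord 0) = - (H t * z t * lam t) * x ord0 (inord 0)) ->
  (forall t, L t * x ord0 (inord 1) = - (H t * z t * lam t) * x ord0 (inord 1)) ->
  (forall t, lam t ^+ 2 * (x ord0 (inord 0) ^+ 2 + x ord0 (inord 1) ^+ 2) +
     z t ^+ 2 = 1) ->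
  integral_curve fast_field (spiral x z lam).
Proof.
move=> HE dz dl L0 L1 nrm t.
have c2s2 := cos2Dsin2 t.
split.
  apply: S2_row3; rewrite -(nrm t).
  set a := x _ _; set b := x _ _; rewrite -[in RHS](mulr1 (a ^+ 2 + b ^+ 2)) -c2s2.
  ring.
rewrite fast_fieldE /drift /height; rewrite /spiral.
case: (row3E (lam t * (x ord0 (inord 0) * cos t - x ord0 (inord 1) * sin t))
       (lam t * (x ord0 (inord 0) * sin t + x ord0 (inord 1) * cos t)) (z t))
  => -> -> ->.
rewrite -HE; have l0 := L0 t; have l1 := L1 t.
set a := x ord0 (inord 0) in l0 *; set b := x ord0 (inord 1) in l1 *.
have dc : is_derive t (1 : R) (fun t => a * cos t - b * sin t)
    (- a * sin t - b * cos t).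
  by apply: is_derive_eq; rewrite /GRing.scale /=; ring.
have ds : is_derive t (1 : R) (fun t => a * sin t + b * cos t) (a * cos t - b * sin t).
  by apply: is_derive_eq; rewrite /GRing.scale /=; ring.
apply: is_derive_row3 => //.
- apply: (is_derive_eq (is_deriveM (dl t) dc)); rewrite /GRing.scale /=.
  rewrite [X in _ + X](_ : _ = (L t * a) * cos t - (L t * b) * sin t); last by ring.
  by rewrite l0 l1; ring.
- apply: (is_derive_eq (is_deriveM (dl t) ds)); rewrite /GRing.scale /=.
  rewrite [X in _ + X](_ : _ = (L t * a) * sin t + (L t * b) * cos t); last by ring.
  by rewrite l0 l1; ring.
Qed.

Definition rotate t x : vec := spiral x (cst (x ord0 (inord 2))) (cst 1) t.

Lemma rotate_integral_curve x : S2 x ->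
  drift x * (1 - x ord0 (inord 2) ^+ 2) = 0 ->
  integral_curve fast_field (fun t => rotate t x).
Proof.
move=> /S2E Sx st.
(* Either the drift vanishes, or [x] is a pole and its horizontal coordinates do. *)
have e k : (k = 0)%N \/ (k = 1)%N -> drift x * x ord0 (inord 2) * x ord0 (inord k) = 0.
  move=> k01; move/eqP: st; rewrite mulf_eq0 => /orP[/eqP ->|/eqP z1].
    by rewrite !mul0r.
  have [|x0 x1] := @sum_sqr_eq0 R (x ord0 (inord 0)) (x ord0 (inord 1)).
    by move: Sx z1; lra.
  by case: k01 => ->; rewrite ?x0 ?x1 mulr0.
apply: (@spiral_integral_curve x (cst (x ord0 (inord 2))) (cst 1)
  (cst (drift x)) (cst 0)) => //=.
- by move=> t; rewrite st; exact: is_derive_cst.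
- by move=> t; rewrite mul0r mulr1 mulNr e ?oppr0//; left.
- by move=> t; rewrite mul0r mulr1 mulNr e ?oppr0//; right.
- by move=> t; rewrite expr1n mul1r.
Qed.

End Fields.

(** * Stationary heights and the explicit drifting curves *)

Section Curves.
Variable R : realType.
Local Notation vec := (vec R).
Implicit Types (x y : vec) (s t u : R).

Lemma sinsq_addn (n : nat) u : sinsq (n%:R + u) = sinsq u.
Proof.
rewrite /sinsq !fctE mulrDr [pi * n%:R]mulr_natr addrC (alternatingn (@sinDpi R)).
by rewrite mulrACA -expr2 sqrr_sign mul1r.
Qed.

Lemma sinsq_ge0 u : 0 <= sinsq u.
Proof. by rewrite /sinsq !fctE -expr2 sqr_ge0. Qed.

Lemma sinsq_nat (n : nat) : sinsq n%:R = 0 :> R.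
Proof. by rewrite -[n%:R]addr0 sinsq_addn /sinsq !fctE mulr0 sin0 mulr0. Qed.

Lemma sinsq_gt0 u : 0 < u < 1 -> 0 < sinsq u.
Proof.
move=> /andP[u0 u1]; have : 0 < sin (pi * u).
  by apply: sin_gt0_pi; rewrite mulr_gt0 ?pi_gt0//= gtr_pMr// pi_gt0.
by move=> s0; rewrite /sinsq !fctE mulr_gt0.
Qed.

Lemma sinsq_eq0 u : 0 <= u -> sinsq u = 0 -> u = (Num.truncn u)%:R.
Proof.
move=> u0; have /andP[nu un] := truncn_itv u0; set n := Num.truncn u in nu un *.
rewrite -[X in sinsq X](subrK n%:R) addrC sinsq_addn => s0.
apply/eqP; rewrite eq_le nu andbT leNgt; apply/negP => nu'.
suff : 0 < sinsq (u - n%:R) by rewrite s0 ltxx.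
by apply: sinsq_gt0; rewrite subr_gt0 nu' ltrBlDl natr1.
Qed.

Lemma drift_ge0 x : 0 <= drift x.
Proof.
rewrite /drift /flat; case: ifP => // _.
by rewrite mulr_ge0 ?sinsq_ge0 ?expR_ge0.
Qed.

Lemma sqr_z_le1 x : S2 x -> 0 <= 1 - x ord0 (inord 2) ^+ 2.
Proof. by move=> /S2_coord_le1-/(_ (inord 2)); rewrite ler_norml; nra. Qed.

Lemma heightK x : x ord0 (inord 2) = 1 - 2 * height x.
Proof. by rewrite /height; field. Qed.

(* With [0^-1 = 0] the case [n = 0] is the north pole; [n = 1] is the south pole. *)
Lemma stationaryP x : S2 x ->
  drift x * (1 - x ord0 (inord 2) ^+ 2) = 0 <-> exists n : nat, height x = n%:R^-1.
Proof.
move=> Sx; split; last first.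
  move=> [n hn]; rewrite /drift hn; case: n {hn} => [|n].
    by rewrite invr0 flat_le0// mul0r.
  by rewrite flat_gt0 ?invr_gt0 ?ltr0n// invrK sinsq_nat !mul0r.
have /andP[h0 h1] := height_S2 Sx.
move/eqP; rewrite mulf_eq0 => /orP[/eqP|/eqP].
  rewrite /drift; move: h0; rewrite le_eqVlt => /predU1P[<- _|h0].
    by exists 0%N; rewrite invr0.
  rewrite flat_gt0// => /eqP; rewrite mulf_eq0 (gt_eqF (expR_gt0 _)) orbF => /eqP.
  move=> /sinsq_eq0; rewrite invr_ge0 => /(_ (ltW h0)) e.
  by exists (Num.truncn (height x)^-1); rewrite -e invrK.
rewrite heightK => e.
have /eqP : height x * (1 - height x) = 0 by move: e; lra.
rewrite mulf_eq0 => /orP[/eqP ->|]; first by exists 0%N; rewrite invr0.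
by rewrite subr_eq0 => /eqP <-; exists 1%N; rewrite invr1.
Qed.

(** With [w = 1 / s], so [z = 1 - 2 / w], the vertical equation [z' = h (1 - z^2)] reads
    [w' = 2 (w - 1) sin^2 (pi w) exp (- w)]. For [w = U p] both [sin^2 (pi w)] and [pi U'] equal
    [1 / (1 + p^2)]; they cancel and leave [p' = G p]. *)
Lemma drifting_curve x : S2 x -> drift x * (1 - x ord0 (inord 2) ^+ 2) != 0 ->
  exists c : R -> vec, c 0 = x /\ integral_curve (@fast_field R) c.
Proof.
move=> Sx ns; have /andP[h0 h1] := height_S2 Sx.
have nst n : height x = n%:R^-1 -> False.
  by move=> e; move/eqP: ns; apply; apply/(stationaryP Sx); exists n.
have {}h0 : 0 < height x.
  rewrite lt_def h0 andbT; apply/eqP => e; apply: (nst 0%N).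
  by rewrite invr0.
have {}h1 : height x < 1.
  by rewrite lt_def h1 andbT; apply/eqP => e; apply: (nst 1%N); rewrite invr1.
pose u := (height x)^-1.
have u1 : 1 < u by rewrite /u invf_gt1.
have u0 : 0 <= u by exact: le_trans ler01 (ltW u1).
have /andP[nu un] := truncn_itv u0; pose n := Num.truncn u.
rewrite -/n in nu un.
(* The height of [x] is no [1 / n], so [u] is not an integer and lies in the open range of [U]. *)
have {}nu : n%:R < u.
  rewrite lt_def nu andbT; apply/eqP => e.
  by apply: (nst n); rewrite -e /u invrK.
have n1 : (1 <= n)%N.
  by rewrite lt0n; apply/eqP => n0; move: un; rewrite n0 ltNge (ltW u1).
have n1R : 1 <= n%:R :> R by rewrite ler1n.
have pi0 := @pi_gt0 R.
pose U p : R := n%:R + (2^-1 + atan p / pi).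
have UP p : n%:R < U p < n%:R + 1.
  rewrite /U ltrDl ltrD2l; apply/andP; split.
    rewrite -ltrBlDl sub0r ltr_pdivlMr// mulNr mulrC; exact: atan_gtNpi2.
  have : atan p / pi < 2^-1 by rewrite ltr_pdivrMr// mulrC; exact: atan_ltpi2.
  by lra.
have sU p : sinsq (U p) = (1 + p ^+ 2)^-1.
  rewrite /U sinsq_addn /sinsq !fctE -expr2.
  rewrite (_ : pi * (2^-1 + atan p / pi) = atan p + pi / 2); last first.
    by rewrite mulrDr addrC mulrCA divff ?mulr1// gt_eqF.
  rewrite sinDpihalf cos_atan exprVn sqr_sqrtr//.
  by rewrite addr_ge0// sqr_ge0.
have dU p : is_derive p (1 : R) U ((1 + p ^+ 2)^-1 / pi).
  have da : is_derive p (1 : R) (fun p => atan p / pi) ((1 + p ^+ 2)^-1 / pi).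
    have -> : (fun p : R => atan p / pi) = (pi^-1 : R) \*: (@atan R).
      by apply/funext => q; rewrite /= mulrC.
    by apply: (is_derive_eq (is_deriveZ _ (is_derive1_atan p))); rewrite [_ *: _]mulrC.
  have -> : U = cst n%:R + (cst 2^-1 + (fun p => atan p / pi)) by [].
  apply: (is_derive_eq (is_deriveD (is_derive_cst _ _ _)
    (is_deriveD (is_derive_cst _ _ _) da))).
  by rewrite !add0r.
pose G p : R := 2 * pi * (U p - 1) * expR (- U p).
have cU : continuous U by move=> p; exact: (is_derive_continuous (dU p)).
have cG : continuous G.
  move=> p; apply: cvgM.
    apply: cvgM; first exact: cst_continuous.
    by apply: cvgB; [exact: cU|exact: cst_continuous].
  apply: (@continuous_comp _ _ _ (fun p => - U p) expR); last exact: continuous_expR.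
  by apply: cvgN; exact: cU.
have GM p : 0 < G p <= 2 * pi * n%:R.
  have /andP[U1 U2] := UP p.
  have U0 : 0 < U p - 1 by rewrite subr_gt0 (le_lt_trans n1R).
  have p2 : 0 < 2 * pi :> R by rewrite mulr_gt0.
  rewrite /G mulr_gt0 ?expR_gt0 ?mulr_gt0//= -[leRHS]mulr1 ler_pM ?expR_ge0//.
  - by rewrite mulr_ge0// ltW.
  - by rewrite ler_pM2l// lerBlDr ltW.
  - by rewrite expR_le1 oppr_le0; move: U0; lra.
have [tau [_ dtau _ stau]] := autonomous_ode_solution cG GM.
(* The value of [p] with [U p = u]; the solution is onto, so it passes there at some time [t0],
   which becomes the origin of time. *)
have [t0 tau0] := stau (tan (pi * (u - n%:R - 2^-1))).
pose w t := U (tau (t0 + t)).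
have w0 : w 0 = u.
  rewrite /w addr0 tau0 /U tanK; first by rewrite mulrAC divff ?gt_eqF// mul1r; ring.
  rewrite in_itv /=; move: un; rewrite -natr1 => un.
  rewrite (_ : - (pi / 2) = pi * (- 2^-1)); last by rewrite mulrN.
  by rewrite !ltr_pM2l//; move: nu un; lra.
have wP t : 1 < w t by have /andP[+ _] := UP (tau (t0 + t)); exact: le_lt_trans.
have wn0 t : w t != 0 by rewrite gt_eqF// (lt_trans _ (wP t)).
have dw t : is_derive t (1 : R) w (2 * (w t - 1) * (sinsq (w t) * expR (- w t))).
  have dsh : is_derive t (1 : R) (fun t => t0 + t) 1.
    by apply: (is_derive_eq (is_deriveD (is_derive_cst t0 t 1) (is_derive_id t 1)));
      rewrite add0r.
  have d1 := is_derive1_comp (dtau (t0 + t)) dsh.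
  apply: (is_derive_eq (is_derive1_comp (dU (tau (t0 + t))) d1)).
  rewrite -sU -/(w t) /G mulr1 -/(w t).
  have gen (P a b : R) : 0 < P -> a / P * (2 * P * (b - 1) * expR (- b)) =
      2 * (b - 1) * (a * expR (- b)) by move=> P0; field; rewrite gt_eqF.
  exact: gen.
pose z t : R := 1 - 2 * (w t)^-1.
pose H t := flat (@sinsq R) ((1 - z t) / 2).
have HE t : H t = sinsq (w t) * expR (- w t).
  rewrite /H (_ : (1 - z t) / 2 = (w t)^-1); last by rewrite /z; field.
  by rewrite flat_gt0 ?invrK// invr_gt0 (lt_trans _ (wP t)).
have z2 t : 1 - z t ^+ 2 = 4 * (w t - 1) / w t ^+ 2 by rewrite /z; field.
have dz t : is_derive t (1 : R) z (H t * (1 - z t ^+ 2)).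
  have dv := is_deriveV (wn0 t) (dw t).
  have -> : z = cst 1 - (2 : R) \*: (fun t => (w t)^-1) by [].
  apply: (is_derive_eq (is_deriveB (is_derive_cst _ _ _) (is_deriveZ 2 dv))).
  rewrite HE z2 /GRing.scale /=; by field.
have z2gt0 t : 0 < 1 - z t ^+ 2.
  rewrite z2; apply: divr_gt0; first by rewrite mulr_gt0// subr_gt0.
  by rewrite exprn_gt0// (lt_trans _ (wP t)).
have z0 : z 0 = x ord0 (inord 2).
  by rewrite /z w0 /u invrK heightK.
pose r0 := 1 - x ord0 (inord 2) ^+ 2.
have r0gt0 : 0 < r0 by rewrite /r0 -z0.
pose lam t := Num.sqrt ((1 - z t ^+ 2) / r0).
have lam0 : lam 0 = 1 by rewrite /lam z0 divff ?sqrtr1// gt_eqF.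
have qgt0 t : 0 < (1 - z t ^+ 2) / r0 by rewrite divr_gt0.
have lamgt0 t : 0 < lam t by rewrite sqrtr_gt0.
have lam2 t : lam t ^+ 2 = (1 - z t ^+ 2) / r0 by rewrite sqr_sqrtr// ltW.
have dlam t : is_derive t (1 : R) lam (- (H t * z t * lam t)).
  have dq : is_derive t (1 : R) (fun t => (1 - z t ^+ 2) / r0)
      (- 2 * z t * (H t * (1 - z t ^+ 2)) / r0).
    have -> : (fun t => (1 - z t ^+ 2) / r0) = (r0^-1 : R) \*: (cst 1 - z ^+ 2).
      by apply/funext => q; rewrite /= mulrC.
    apply: (is_derive_eq (is_deriveZ _ (is_deriveB (is_derive_cst _ _ _)
      (is_deriveX 2 (dz t))))).
    by rewrite /GRing.scale /= expr1; ring.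
  apply: (is_derive_eq (@is_derive1_comp R Num.sqrt (fun t => (1 - z t ^+ 2) / r0)
    t _ _ (is_derive1_sqrt (qgt0 t)) dq)).
  rewrite -/(lam t).
  have -> : - 2 * z t * (H t * (1 - z t ^+ 2)) / r0 =
      - 2 * z t * H t * lam t ^+ 2 by rewrite lam2; ring.
  by field; rewrite gt_eqF.
exists (spiral x z lam); split.
  rewrite /spiral lam0 z0 cos0 sin0 !mul1r !mulr1 !mulr0 subr0 add0r.
  by rewrite -row3_eta.
apply: (@spiral_integral_curve R x z lam H (fun t => - (H t * z t * lam t))) => // t.
rewrite lam2; move/S2E: Sx => Sx.
have -> : x ord0 (inord 0) ^+ 2 + x ord0 (inord 1) ^+ 2 = r0.
  by rewrite /r0 -[X in X - _]Sx addrK.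
by rewrite divfK ?subrK// gt_eqF.
Qed.

End Curves.

(** * Construction of the two flows and their behaviour on the parallels *)

Section FastAndSlowFlows.
Variable R : realType.
Local Notation vec := (vec R).
Implicit Types (x y : vec) (s t a b : R) (phi : vec -> R -> vec).

Lemma rotate_coord t x : [/\
  rotate t x ord0 (inord 0) = x ord0 (inord 0) * cos t - x ord0 (inord 1) * sin t,
  rotate t x ord0 (inord 1) = x ord0 (inord 0) * sin t + x ord0 (inord 1) * cos t &
  rotate t x ord0 (inord 2) = x ord0 (inord 2)].
Proof.
rewrite /rotate /spiral /= !mul1r.
by case: (row3E (x ord0 (inord 0) * cos t - x ord0 (inord 1) * sin t)
  (x ord0 (inord 0) * sin t + x ord0 (inord 1) * cos t) (x ord0 (inord 2))).
Qed.

Lemma rotate0 x : rotate 0 x = x.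
Proof.
have [e0 e1 e2] := rotate_coord 0 x.
by apply: vec3P => //; rewrite ?e0 ?e1 cos0 sin0; ring.
Qed.

Lemma height_rotate t x : height (rotate t x) = height x.
Proof. by have [_ _ e] := rotate_coord t x; rewrite /height e. Qed.

Lemma rotate_2pi x : rotate (pi *+ 2) x = x.
Proof.
have [e0 e1 e2] := rotate_coord (pi *+ 2) x.
by apply: vec3P => //; rewrite ?e0 ?e1 cos2pi sin2pi; ring.
Qed.

Lemma polar_angle (c s : R) : c ^+ 2 + s ^+ 2 = 1 ->
  exists a, cos a = c /\ sin a = s.
Proof.
move=> e.
have c1 : -1 <= c <= 1 by apply/andP; split; nra.
have sE : sin (acos c) = `|s|.
  by rewrite sin_acos// -sqrtr_sqr; congr Num.sqrt; rewrite -e addrC addKr.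
have cE : cos (acos c) = c by apply: acosK; rewrite in_itv.
have [s0|s0] := leP 0 s.
  by exists (acos c); rewrite sE cE ger0_norm.
by exists (- acos c); rewrite cosN sinN sE cE ltr0_norm ?opprK.
Qed.

Lemma rotate_transitive x y : S2 x -> S2 y -> height x = height y ->
  exists a, y = rotate a x.
Proof.
move=> /S2E Sx /S2E Sy hxy.
have zz : x ord0 (inord 2) = y ord0 (inord 2) by rewrite !heightK hxy.
set x0 := x ord0 (inord 0) in Sx; set x1 := x ord0 (inord 1) in Sx.
set y0 := y ord0 (inord 0) in Sy; set y1 := y ord0 (inord 1) in Sy.
pose r := x0 ^+ 2 + x1 ^+ 2.
have ry : y0 ^+ 2 + y1 ^+ 2 = r by move: Sx Sy; rewrite zz /r; lra.
have [r0|r0] := eqVneq r 0.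
  rewrite r0 in ry; have [ex0 ex1] := sum_sqr_eq0 r0; have [ey0 ey1] := sum_sqr_eq0 ry.
  exists 0; rewrite rotate0; apply: vec3P => //.
    by rewrite -/y0 ey0 -ex0.
  by rewrite -/y1 ey1 -ex1.
(* Cosine and sine of the angle between the horizontal parts, from their dot and cross products;
   Lagrange's identity puts the pair on the unit circle. *)
have [|a [ca sa]] := @polar_angle ((x0 * y0 + x1 * y1) / r) ((x0 * y1 - x1 * y0) / r).
  rewrite !exprMn -mulrDl exprVn.
  apply: (@mulIf _ (r ^+ 2)); first by rewrite expf_neq0.
  rewrite divfK ?expf_neq0// mul1r.
  transitivity (r * (y0 ^+ 2 + y1 ^+ 2)); last by rewrite ry.
  by rewrite /r; ring.
exists a; have [e0 e1 e2] := rotate_coord a x; apply: vec3P.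
- rewrite e0 ca sa -/x0 -/x1 -/y0.
  by rewrite !mulrA -mulrBl; apply: (canRL (mulfK r0)); rewrite {1}/r; ring.
- rewrite e1 ca sa -/x0 -/x1 -/y1.
  by rewrite !mulrA -mulrDl; apply: (canRL (mulfK r0)); rewrite {1}/r; ring.
- by rewrite e2.
Qed.

Definition flow_of (V : vec -> vec) phi :=
  forall x, S2 x -> phi x 0 = x /\ integral_curve V (phi x).

Lemma fast_flow_exists : exists phi, flow_of (@fast_field R) phi.
Proof.
have /choice[phi phiP] (x : vec) : exists c : R -> vec,
    S2 x -> c 0 = x /\ integral_curve (@fast_field R) c.
  have [Sx|nSx] := pselect (S2 x); last by exists (cst 0).
  have [st|ns] := eqVneq (drift x * (1 - x ord0 (inord 2) ^+ 2)) 0.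
    exists (fun t => rotate t x) => _; split; first exact: rotate0.
    exact: rotate_integral_curve.
  by have [c cP] := drifting_curve Sx ns; exists c.
by exists phi.
Qed.

Lemma fast_lipschitz : exists K, lipschitz_S2 (@fast_field R) K.
Proof. exact: lipschitz_elem_field (@elem_fast_coord R). Qed.

Lemma slow_lipschitz : exists K, lipschitz_S2 (@slow_field R) K.
Proof. exact: lipschitz_elem_field (@elem_slow_coord R). Qed.

Lemma Cinf_flow_of (f : 'I_3 -> vec -> R) phi : (forall i, elem (f i)) ->
  flow_of (fun x => \row_i f i x) phi -> Cinf_flow_S2 phi.
Proof.
move=> ef fphi; have [K lK] := lipschitz_elem_field ef; split.
  by apply: (is_flow_of_curves lK) => x /fphi[].
exists (fun x => \row_i f i x); split; first exact: smooth_elem.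
by move=> x t /fphi[_] /(_ t)[].
Qed.

Lemma fast_flow_rotate phi x (n : nat) t : flow_of (@fast_field R) phi -> S2 x ->
  height x = n%:R^-1 -> phi x t = rotate t x.
Proof.
move=> fphi Sx hx; have [p0 pV] := fphi x Sx; have [K lK] := fast_lipschitz.
apply: (integral_curve_unique lK pV (d := fun t => rotate t x)) => /=; last first.
  by rewrite p0 rotate0.
by apply: rotate_integral_curve => //; apply/(stationaryP Sx); exists n.
Qed.

(** The height is constant along the parallel, so there the slow field is the fast one with time
    rescaled by [1 / n]. For [n = 0] the speed is [0], as it must be at the north pole. *)
Lemma slow_flow_rotate phi x (n : nat) t : flow_of (@slow_field R) phi -> S2 x ->
  height x = n%:R^-1 -> phi x t = rotate (n%:R^-1 * t) x.
Proof.
move=> fphi Sx hx; have [p0 pV] := fphi x Sx; have [K lK] := slow_lipschitz.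
pose c := (fun t => rotate t x) \o (fun t => n%:R^-1 * t).
apply: (integral_curve_unique lK pV (d := c)) => /=; last first.
  by rewrite p0 /c /= mulr0 rotate0.
have rc : integral_curve (@fast_field R) (fun t => rotate t x).
  by apply: rotate_integral_curve => //; apply/(stationaryP Sx); exists n.
move=> u; have [Su du] := rc (n%:R^-1 * u); split=> //.
rewrite slow_fieldE /c /= height_rotate hx; apply: is_derive_comp_row du _.
by apply: is_derive_eq; rewrite [_ *: _]mulr1.
Qed.

Lemma rotate_pole t x : S2 x -> height x = 0 -> rotate t x = x.
Proof.
move=> /S2E Sx h0; have [e0 e1 e2] := rotate_coord t x.
have z1 : x ord0 (inord 2) = 1 by rewrite heightK h0 mulr0 subr0.
have [|x0 x1] := @sum_sqr_eq0 R (x ord0 (inord 0)) (x ord0 (inord 1)).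
  by move: Sx; rewrite z1; lra.
by apply: vec3P => //; rewrite ?e0 ?e1 x0 x1; ring.
Qed.

Lemma fast_flow_pole phi x t : flow_of (@fast_field R) phi -> S2 x ->
  height x = 0 -> phi x t = x.
Proof.
move=> fphi Sx h0; rewrite (@fast_flow_rotate phi x 0) ?rotate_pole//.
by rewrite invr0.
Qed.

(* Both fields have the same oriented orbits since they differ by the positive
   factor [height], which vanishes only at the north pole, a common zero. *)
Lemma slow_flow_exists phihat : flow_of (@fast_field R) phihat ->
  exists phi, flow_of (@slow_field R) phi /\
    forall x, S2 x -> exists tau : R -> R, [/\ tau 0 = 0,
      {homo tau : a b / a < b}, forall b, exists a, tau a = b &
      forall t, phi x t = phihat x (tau t)].
Proof.
move=> fh; have [K lK] := fast_lipschitz.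
have /choice[tau tauP] (x : vec) : exists tau : R -> R, S2 x -> [/\ tau 0 = 0,
    {homo tau : a b / a < b}, forall b, exists a, tau a = b &
    integral_curve (@slow_field R) (phihat x \o tau)].
  have [Sx|nSx] := pselect (S2 x); last by exists id.
  have [p0 pV] := fh x Sx.
  have [h0|hn0] := eqVneq (height x) 0.
    exists id => _; split=> //; first by move=> b; exists b.
    have -> : phihat x \o id = cst x.
      by apply/funext => t; rewrite /= fast_flow_pole.
    move=> t; split=> //=; rewrite slow_fieldE h0 scale0r.
    exact: is_derive_cst.
  have hpos t : 0 < height (phihat x t) <= 1.
    have St := (pV t).1; have /andP[h0 ->] := height_S2 St; rewrite andbT.
    rewrite lt_def h0 andbT; apply/eqP => ht; move/eqP: hn0; apply.
    (* A curve that reached the north pole would, by uniqueness, be constant, and [x] would be the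
       pole. *)
    have := integral_curve_unique lK (integral_curve_shift t pV) (fh _ St).2.
    rewrite addr0 (fh _ St).1 => /(_ erefl (- t)); rewrite subrr p0.
    by rewrite fast_flow_pole// => ->.
  have cG : continuous (fun t => height (phihat x t)).
    move=> t; have dp := is_derive_coordinate (inord 2) (pV t).2.
    apply: cvgM; last exact: cst_continuous.
    apply: cvgB; first exact: cst_continuous.
    exact: (is_derive_continuous dp).
  have [tau [t0 dt mt st]] := autonomous_ode_solution cG hpos.
  exists tau => _; split=> // t; split; first exact: (pV _).1.
  by rewrite /= slow_fieldE; exact: is_derive_comp_row (pV _).2 (dt t).
exists (fun x => phihat x \o tau x); split=> [x Sx|x Sx].
  by have [t0 _ _ ic] := tauP x Sx; rewrite /= t0; split=> //; exact: (fh x Sx).1.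
by have [t0 mt st _] := tauP x Sx; exists (tau x).
Qed.

(** The coordinate [z] is nondecreasing and takes the same value at [0] and [s], so it is constant
    in between. The mean value theorem gives a time [m] of zero vertical speed, and that speed
    depends on [z] only. *)
Lemma periodic_stationary (c : R -> vec) s : integral_curve (@fast_field R) c ->
  0 < s -> c s = c 0 -> drift (c 0) * (1 - c 0 ord0 (inord 2) ^+ 2) = 0.
Proof.
move=> cV s0 cs; pose z t := c t ord0 (inord 2).
pose dz t := drift (c t) * (1 - z t ^+ 2).
have zP t : is_derive t (1 : R) z (dz t).
  have := is_derive_coordinate (inord 2) (cV t).2.
  rewrite fast_fieldE; set a := _ - _; set b := _ - _; set d := _ * (1 - _).
  by case: (row3E a b d) => _ _ ->.
have zle : {homo z : a b / a <= b}.
  apply: (is_derive_ge0_le zP) => t.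
  by rewrite mulr_ge0 ?drift_ge0 ?sqr_z_le1//; exact: (cV t).1.
have [|m] := @MVT R z dz 0 s s0 (fun t _ => zP t).
  by apply: continuous_subspaceT => t; exact: (is_derive_continuous (zP t)).
rewrite in_itv/= => /andP[m0 ms]; rewrite {1}/z cs subrr subr0 => /esym/eqP.
rewrite mulf_eq0 (gt_eqF s0) orbF => /eqP dz0.
have zm : z m = z 0.
  have zs : z s = z 0 by rewrite /z cs.
  by apply/eqP; rewrite eq_le -{1}zs !zle// ltW.
move: dz0; rewrite /dz zm /drift (_ : height (c m) = height (c 0))//.
by rewrite /height -/(z m) zm.
Qed.

End FastAndSlowFlows.

(** * Periodic orbits, their isolation and their periods *)

Section PeriodicOrbits.
Variable R : realType.
Local Notation vec := (vec R).
Implicit Types (x y : vec) (s t : R) (phi : vec -> R -> vec) (n m : nat).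

(** What the two flows share: this description of the periodic orbits survives a time change and
    suffices for isolation. The periods are treated separately. *)
Definition parallel_flow phi :=
  (forall x s, S2 x -> 0 < s -> phi x s = x -> exists n, height x = n%:R^-1) /\
  (forall x n, S2 x -> height x = n%:R^-1 ->
    orbit phi x = [set y | S2 y /\ height y = height x]).

Lemma fast_parallel_flow phi : flow_of (@fast_field R) phi -> parallel_flow phi.
Proof.
move=> fphi; split=> [x s Sx s0 ps|x n Sx hx].
  apply/(stationaryP Sx); have [p0 pV] := fphi x Sx.
  by rewrite -p0; apply: (periodic_stationary pV s0); rewrite ps.
have [p0 pV] := fphi x Sx; apply/seteqP; split=> [_ [t _ <-]|y /= [Sy hy]].
  by split; [exact: (pV t).1|rewrite (fast_flow_rotate _ fphi Sx hx) height_rotate].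
have [a ->] := rotate_transitive Sx Sy (esym hy).
by exists a => //; rewrite (fast_flow_rotate _ fphi Sx hx).
Qed.

(** Surjectivity of [tau] makes the orbits equal as sets; [tau 0 = 0] and monotonicity send positive
    periods to positive periods. *)
Definition time_change phi phihat := forall x, S2 x -> exists tau : R -> R,
  [/\ tau 0 = 0, {homo tau : a b / a < b}, forall b, exists a, tau a = b &
      forall t, phi x t = phihat x (tau t)].

Lemma time_change_orbit phi phihat x : time_change phi phihat -> S2 x ->
  orbit phi x = orbit phihat x.
Proof.
move=> tc Sx; have [tau [_ _ st pE]] := tc x Sx.
apply/seteqP; split=> _ [t _ <-]; first by rewrite pE; exists (tau t).
by have [a <-] := st t; exists a.
Qed.

Lemma time_change_parallel_flow phi phihat : time_change phi phihat ->
  parallel_flow phihat -> parallel_flow phi.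
Proof.
move=> tc [P1 P2]; split=> [x s Sx s0 ps|x n Sx hx]; last first.
  by rewrite (time_change_orbit tc)//; exact: P2 hx.
have [tau [t0 mt _ pE]] := tc x Sx.
by apply: (P1 x (tau s)) => //; [rewrite -t0 mt|rewrite -pE].
Qed.

Lemma time_change_equivalent phi phihat : time_change phi phihat ->
  equivalent_flows phi phihat.
Proof.
move=> tc; exists id, id; split=> //.
- by split; apply: continuous_subspaceT => x; exact: cvg_id.
- move=> x Sx; split; first by rewrite image_id (time_change_orbit tc).
  by have [tau [_ mt _ pE]] := tc x Sx; exists tau.
Qed.

(** Delimits a band of heights around [1 / n] free of other parallels. The upper end uses
    [n - 1 / 2] because [n - 1] would vanish for [n = 1]; the value [0] given by [m = 0] lies below
    the band. *)
Lemma invn_between n m : (0 < n)%N ->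
  n.+1%:R^-1 < (m%:R^-1 : R) < (n%:R - 2^-1)^-1 -> m = n.
Proof.
move=> n0 /andP[h1 h2]; have n1 : 1 <= n%:R :> R by rewrite ler1n.
have m0 : 0 < m%:R :> R by rewrite -invr_gt0 (lt_trans _ h1)// invr_gt0 ltr0n.
have nh : 0 < n%:R - 2^-1 :> R by move: n1; lra.
move: h1 h2; rewrite !ltf_pV2 ?posrE ?ltr0Sn//.
rewrite ltr_nat ltnS => mn nm; apply/eqP; rewrite eqn_leq mn /= leqNgt.
apply/negP; rewrite -(ler_nat R) -natr1 => mn1; move: nm mn1; lra.
Qed.

(** The isolating neighbourhood is the open band of heights of [invn_between]. The case [n = 0] is
    excluded, since the parallels accumulate at the north pole. *)
Lemma Pt_parallel phi n x s t : parallel_flow phi -> (0 < n)%N -> S2 x ->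
  height x = n%:R^-1 -> 0 < s <= t -> phi x s = x -> Pt phi t (orbit phi x).
Proof.
move=> [P1 P2] n0 Sx hx st ps; split; last by exists x; split => //; exists s.
have [s0 _] := andP st.
split; first by exists x; split => //; exists s.
exists (@height R @^-1` [set r | r \in `]n.+1%:R^-1, (n%:R - 2^-1)^-1[]); split.
- apply: open_comp; last exact: interval_open.
  by move=> y _; exact: height_continuous.
- rewrite (P2 x n)// => y [_ hy] /=; rewrite hy hx in_itv /=.
  have n1 : 1 <= n%:R :> R by rewrite ler1n.
  have nh : 0 < n%:R - 2^-1 :> R by move: n1; lra.
  rewrite !ltf_pV2 ?posrE ?ltr0Sn ?ltr0n// ltr_nat ltnSn /=.
  by rewrite gtrBl invr_gt0.
- move=> _ [y [Sy -> [r [r0 pr]]]] sub.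
  have [m hm] := P1 y r Sy r0 pr.
  have := sub y; rewrite (P2 y m)// => /(_ (conj Sy erefl)) /=.
  rewrite in_itv /= hm => /(invn_between n0) mn.
  by rewrite (P2 x n)// mn hx.
Qed.

Lemma parallel_point n : (0 < n)%N -> exists x : vec, S2 x /\ height x = n%:R^-1.
Proof.
move=> n0; pose z : R := 1 - 2 * n%:R^-1.
have n1 : 0 < (n%:R^-1 : R) <= 1.
  by rewrite invr_gt0 ltr0n n0 /= invf_le1 ?ltr0n// ler1n.
exists (row3 (Num.sqrt (1 - z ^+ 2)) 0 z); split.
  apply: S2_row3; rewrite sqr_sqrtr; first by ring.
  by move: n1; rewrite /z; set a := _^-1; nra.
rewrite /height; case: (row3E (Num.sqrt (1 - z ^+ 2)) 0 z) => _ _ ->.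
by rewrite /z; field; rewrite pnatr_eq0 -lt0n.
Qed.

(** A crude substitute for [2 pi <= a], enough for a linear count: the cosine decreases strictly on
    [[0, pi]], which contains [[0, 1]]. *)
Lemma cos_eq1_ge1 (a : R) : 0 < a -> cos a = 1 -> 1 <= a.
Proof.
move=> a0 ca; rewrite leNgt; apply/negP => a1; have p2 := @pi_ge2 R.
have : cos a < cos 0.
  by rewrite ltr_cos ?in_itv//= ?lexx ?pi_ge0//; move: a0 a1 p2; lra.
by rewrite ca cos0 ltxx.
Qed.

Lemma slow_period_ge phi x n s t : flow_of (@slow_field R) phi -> S2 x ->
  height x = n%:R^-1 -> 1 <= t -> 0 < s <= t -> phi x s = x -> n%:R <= t.
Proof.
move=> fphi Sx hx t1 /andP[s0 st]; rewrite (slow_flow_rotate _ fphi Sx hx) => rx.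
(* At the poles, [n = 0] and [n = 1], every [s] is a period and the bound comes from [1 <= t]. *)
case: n => [|[|n]] in hx rx *; [exact: le_trans ler01 t1|by []|].
set N := n.+2%:R in hx rx *.
have N0 : 0 < N by rewrite ltr0n.
have N2 : 2 <= N by rewrite ler_nat.
have Ni : 0 < N^-1 <= 2^-1 by rewrite invr_gt0 N0 lef_pV2 ?posrE.
have [e0 e1 _] := rotate_coord (N^-1 * s) x; rewrite rx in e0 e1.
have r0 : x ord0 (inord 0) ^+ 2 + x ord0 (inord 1) ^+ 2 != 0.
  move/S2E : (Sx) => Sx'; rewrite heightK hx in Sx'.
  apply/eqP => e; rewrite e in Sx'; move: Ni Sx'; move: (N^-1) => a /andP[a0 a2] ea.
  have : 0 < a * (1 - a) by apply: mulr_gt0 => //; lra.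
  by move: ea; lra.
(* The dot product of the horizontal part of [x] with its rotated copy is the squared radius times
   the cosine; here the copy is [x] itself. *)
have c1 : cos (N^-1 * s) = 1.
  apply: (mulfI r0); rewrite mulr1.
  set a := x ord0 (inord 0) in e0 e1 *; set b := x ord0 (inord 1) in e0 e1 *.
  transitivity (a * (a * cos (N^-1 * s) - b * sin (N^-1 * s)) +
    b * (a * sin (N^-1 * s) + b * cos (N^-1 * s))); first by ring.
  by rewrite -e0 -e1 !expr2.
have := cos_eq1_ge1 _ c1; rewrite mulr_gt0 ?invr_gt0// => /(_ isT).
by rewrite mulrC ler_pdivlMr// mul1r => /le_trans; apply.
Qed.

(** Each orbit is determined by the index [n] of its parallel, and [n <= t] by [slow_period_ge]; the
    indices from [0] to the integer part of [t] give the bound. *)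
Lemma slow_Pt_card phi t m (f : 'I_m -> set vec) : flow_of (@slow_field R) phi ->
  parallel_flow phi -> 1 <= t -> injective f -> (forall i, Pt phi t (f i)) ->
  (m <= (Num.truncn t).+1)%N.
Proof.
move=> fphi [P1 P2] t1 finj fP; have t0 : 0 <= t by exact: le_trans ler01 t1.
have /choice[g gP] i : exists k : 'I_(Num.truncn t).+1, f i =
    [set y | S2 y /\ height y = k%:R^-1].
  have [_ [x [Sx fx [s [st ps]]]]] := fP i.
  have [s0 _] := andP st.
  have [n hn] := P1 x s Sx s0 ps.
  have nt : (n < (Num.truncn t).+1)%N.
    by rewrite ltnS truncn_ge_nat//; exact: slow_period_ge hn t1 st ps.
  by exists (Ordinal nt); rewrite fx (P2 x n)// hn.
have ginj : injective g by move=> i j gij; apply: finj; rewrite !gP gij.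
by have := leq_card g ginj; rewrite !card_ord.
Qed.

End PeriodicOrbits.

(** * Growth rates of the two flows *)

Section GrowthRates.
Variable R : realType.
Local Notation vec := (vec R).
Implicit Types (s t : R) (phi : vec -> R -> vec).

Lemma EP_eq_pinfty phi T : (forall t, T < t -> logcard_over phi t = +oo%E) ->
  EP phi = +oo%E.
Proof.
move=> lT; apply/ereal_inf_pinfty => _ [V [M [_ MV]] <-] /=.
pose t := Num.max T M + 1.
have Tt : T < t by rewrite /t ltr_pwDr// le_max lexx.
have Mt : M < t by rewrite /t ltr_pwDr// le_max lexx orbT.
apply/eqP; rewrite -leye_eq -(lT t Tt).
by apply: ereal_sup_ubound; exists t => //; exact: MV.
Qed.

(** At most linear growth has exponential rate zero, because [ln (t + 1) / t] tends to [0]; the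
    lower bound rules out the value [-oo] of an empty [Pt]. *)
Lemma EP_eq0 phi T : (forall t, T < t -> (0 <= logcard_over phi t)%E) ->
  (forall t, T < t -> (logcard_over phi t <= (ln (t + 1) / t)%:E)%E) ->
  EP phi = 0%E.
Proof.
move=> ge0 le_ln; apply/eqP; rewrite eq_le; apply/andP; split; last first.
  apply: le_ereal_inf_tmp => _ [V [M [_ MV]] <-] /=.
  pose t := Num.max T M + 1.
  have Tt : T < t by rewrite /t ltr_pwDr// le_max lexx.
  have Mt : M < t by rewrite /t ltr_pwDr// le_max lexx orbT.
  apply: (le_trans (ge0 t Tt)).
  by apply: ereal_sup_ubound; exists t => //; exact: MV.
apply/lee_addgt0Pr => e e0; rewrite add0e.
(* The goal becomes [4 (t + 1) <= e^2 t^2], which follows from [4 (t + 1) <= 8 t] for [t >= 1] and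
   [8 <= e^2 t]. *)
pose M := Num.max T (Num.max 1 (8 / e ^+ 2)).
apply: (@le_trans _ _ (ereal_sup (logcard_over phi @` [set t | M < t]))).
  apply: ereal_inf_lbound; exists [set t | M < t] => //.
  by exists M; split => //; exact: num_real.
apply: ge_ereal_sup => _ [t /= + <-]; rewrite /M !gt_max => /and3P[Tt t1 te].
apply: (le_trans (le_ln t Tt)); rewrite lee_fin.
have t0 : 0 < t by exact: lt_trans t1.
rewrite ler_pdivrMr//.
(* [ln (t + 1) = 2 ln (sqrt (t + 1)) <= 2 sqrt (t + 1)] *)
have q0 : 0 < t + 1 by rewrite addr_gt0.
have s0 : 0 < Num.sqrt (t + 1) by rewrite sqrtr_gt0.
have -> : ln (t + 1) = ln (Num.sqrt (t + 1)) *+ 2 by rewrite -lnXn// sqr_sqrtr// ltW.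
apply: (@le_trans _ _ (Num.sqrt (t + 1) * 2)).
  by rewrite mulr_natr lerMn2r/= ltW// ln_sublinear.
rewrite -ler_sqr ?nnegrE ?mulr_ge0 ?ltW// !exprMn sqr_sqrtr ?ltW//.
move: te; rewrite ltr_pdivrMr ?exprn_gt0// => te.
have : 8 * t <= t * e ^+ 2 * t by rewrite ler_pM2r// ltW.
have -> : e ^+ 2 * t ^+ 2 = t * e ^+ 2 * t by ring.
by move=> h; apply: lt_le_trans h; move: t1; lra.
Qed.

Lemma fast_logcard phi t : flow_of (@fast_field R) phi -> pi *+ 2 <= t ->
  logcard_over phi t = +oo%E.
Proof.
move=> fphi t2; have Pphi := fast_parallel_flow fphi.
have p0 : 0 < pi *+ 2 :> R by rewrite mulrn_wgt0 ?pi_gt0.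
have t0 : 0 < t by exact: lt_le_trans t2.
have /choice[x xP] (k : nat) : exists x : vec, S2 x /\ height x = k.+1%:R^-1.
  exact: parallel_point.
(* Enough parallels that [ln n >= A t]; all of them have period [2 pi]. *)
apply/eqyP => A A0; pose n := (Num.truncn (expR (A * t))).+1.
apply: (@le_trans _ _ (ln n%:R / t)%:E).
  rewrite lee_fin ler_pdivlMr// -[A * t]expRK ler_ln ?posrE ?expR_gt0 ?ltr0n//.
  by have /andP[_ /ltW] := truncn_itv (expR_ge0 (A * t)).
apply: ereal_sup_ubound; exists n => //; split=> //.
exists (fun i => orbit phi (x i)); split=> [i j|i]; last first.
  have [Sx hx] := xP i; apply: (Pt_parallel Pphi _ Sx hx (s := pi *+ 2)) => //.
    by rewrite p0.
  by rewrite (fast_flow_rotate _ fphi Sx hx) rotate_2pi.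
have [Si hi] := xP i; have [Sj hj] := xP j.
rewrite (Pphi.2 _ _ Si hi) (Pphi.2 _ _ Sj hj) => /seteqP[/(_ _ (conj Si erefl))[_]] + _.
rewrite hi hj => /invr_inj/eqP; rewrite eqr_nat eqSS => /eqP ij.
exact: val_inj.
Qed.

Lemma slow_EP phi : flow_of (@slow_field R) phi -> parallel_flow phi -> EP phi = 0%E.
Proof.
move=> fphi Pphi; have p2 := @pi_ge2 R.
apply: (@EP_eq0 _ (pi *+ 2)) => t tp.
  (* The south pole, of height [1], is an isolated orbit, so [Pt] is nonempty. *)
  have [x [Sx hx]] := @parallel_point R 1 isT.
  apply: ereal_sup_ubound; exists 1%N; last by rewrite ln1 mul0r.
  split=> //; exists (fun=> orbit phi x); split=> [i j _|_].
    by rewrite !ord1.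
  apply: (Pt_parallel Pphi _ Sx hx (s := pi *+ 2)) => //.
    by rewrite mulrn_wgt0 ?pi_gt0//= ltW.
  by rewrite (slow_flow_rotate _ fphi Sx hx) invr1 mul1r rotate_2pi.
have t1 : 1 <= t by apply: le_trans (ltW tp); rewrite mulr2n; lra.
have t0 : 0 < t by exact: lt_le_trans t1.
apply: ge_ereal_sup => _ [m [m0 [f [finj fP]]] <-].
rewrite lee_fin ler_pM2r ?invr_gt0// ler_ln ?posrE ?ltr0n ?addr_gt0//.
have := slow_Pt_card fphi Pphi t1 finj fP; rewrite -(ler_nat R) => /le_trans; apply.
by rewrite -natr1 lerD2r truncn_le ltW.
Qed.

End GrowthRates.

Theorem theorem1 (R : realType) :
  exists phi phihat : vec R -> R -> vec R,
    [/\ Cinf_flow_S2 phi, Cinf_flow_S2 phihat, equivalent_flows phi phihat,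
        EP phi = 0%E & EP phihat = +oo%E].
Proof.
have [phihat fhat] := fast_flow_exists R.
have [phi [fphi tc]] := slow_flow_exists fhat.
exists phi, phihat; split.
- exact: Cinf_flow_of (@elem_slow_coord R) fphi.
- exact: Cinf_flow_of (@elem_fast_coord R) fhat.
- exact: time_change_equivalent.
- apply: slow_EP => //; apply: time_change_parallel_flow tc _.
  exact: fast_parallel_flow.
- apply: (@EP_eq_pinfty _ _ (pi *+ 2)) => t /ltW; exact: fast_logcard.
Qed.
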